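(* Let $V$ and $W$ be optimal prefix-free machines, and let $f\colon\mathbb{N}\to\mathbb{N}$ be an order function. Then the following two conditions are equivalent: (i) There exists $c\in\mathbb{N}$ such that $\mathrm{Pf}(\Omega_V)$ is reducible to $\operatorname{dom}W$ in query size $f(n)+c$ (that is, in query size given by the function $n\mapsto f(n)+c$). (ii) $\sum_{n=0}^{\infty}2^{n-f(n)}<\infty$.
   Context: $\{0,1\}^*$ is the set of finite binary strings and $|x|$ is the length of $x$. A prefix-free machine is a partial recursive function $F\colon\{0,1\}^*\to\{0,1\}^*$ whose domain $\operatorname{dom}F$ is prefix-free. A prefix-free machine $V$ is optimal if for each prefix-free machine $F$ there exists $d\in\mathbb{N}$ such that for every $p\in\operatorname{dom}F$ there is $q\in\operatorname{dom}V$ with $V(q)=F(p)$ and $|q|\le|p|+d$. $\Omega_V=\sum_{p\in\operatorname{dom}V}2^{-|p|}$. For a real $\alpha$ and $n\in\mathbb{N}$, $\alpha\!\upharpoonright_n\in\{0,1\}^*$ denotes the first $n$ bits of the base-two expansion of $\alpha-\lfloor\alpha\rfloor$ with infinitely many zeros, and $\mathrm{Pf}(\alpha)=\{\alpha\!\upharpoonright_n\mid n\in\mathbb{N}\}\subset\{0,1\}^*$. For $f\colon\mathbb{N}\to\mathbb{N}$ and $A,B\subset\{0,1\}^*$, $A$ is reducible to $B$ in query size $f$ if there exists an oracle deterministic Turing machine $M$ such that $A$ is Turing reducible to $B$ via $M$ and, on every input $x\in\{0,1\}^*$, $M$ only queries strings of length at most $f(|x|)$. An order function is a non-decreasing total recursive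 function $f\colon\mathbb{N}\to\mathbb{N}$ with $\lim_{n\to\infty}f(n)=\infty$. *)

(* Defs.v *)
From HB Require Import structures.
From mathcomp Require Import all_boot all_order all_algebra.
From mathcomp Require Import all_classical all_reals all_analysis.
Set Implicit Arguments.
Unset Strict Implicit.
Unset Printing Implicit Defensive.
Import Order.TTheory GRing.Theory Num.Theory numFieldNormedType.Exports.

Local Open Scope classical_set_scope.
Local Open Scope ring_scope.

Definition str := seq bool.

(* Deterministic oracle Turing machines, with finitely many two-way infinite
   tapes over an arbitrary finite alphabet containing 0, 1 and a blank. *)

(* [None] is the blank; [aux] holds the symbols other than 0, 1, blank. *)
Definition symbol (aux : finType) : finType := option (bool + aux)%type.

Inductive dir := Left | Right | Stay.

Inductive action (state tapes aux : finType) : Type :=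
| Halt
  (* ask the oracle about the string on the query tape, and go to the first
     state on a positive answer, to the second on a negative one *)
| Query of state & state
  (* from the scanned symbols: the next state and, for each tape, the symbol
     to write and the head move *)
| Move of ({ffun tapes -> symbol aux} ->
           state * (tapes -> symbol aux * dir)).

Record oracle_tm := OracleTM {
  tm_state : finType;
  tm_tapes : finType;
  tm_aux : finType;
  tm_start : tm_state;
  tm_io : tm_tapes;      (* holds the input, and the output upon halting *)
  tm_query : tm_tapes;   (* may coincide with [tm_io] *)
  tm_prog : tm_state -> action tm_state tm_tapes tm_aux }.

(* [(l, r)]: [l] is the tape to the left of the head, nearest cell first; [r]
   is the rest, scanned cell first; all cells beyond [l] and [r] are blank. *)
Definition tape (aux : finType) : Type :=
  (seq (symbol aux) * seq (symbol aux))%type.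

Definition scanned (aux : finType) (t : tape aux) : symbol aux :=
  head None t.2.

Definition write_move (aux : finType) (sd : symbol aux * dir) (t : tape aux) :
    tape aux :=
  let r := sd.1 :: behead t.2 in
  match sd.2 with
  | Left => (behead t.1, head None t.1 :: r)
  | Right => (sd.1 :: t.1, behead t.2)
  | Stay => (t.1, r)
  end.

Fixpoint leading_bits (aux : finType) (s : seq (symbol aux)) : str :=
  if s is Some (inl b) :: s' then b :: leading_bits s' else [::].

(* The string a tape holds: the bits from the scanned cell up to, excluding,
   the first cell to the right that is not a bit. *)
Definition tape_str (aux : finType) (t : tape aux) : str := leading_bits t.2.

Definition str_tape (aux : finType) (x : str) : tape aux :=
  ([::], [seq Some (inl b) | b <- x]).

Definition config (M : oracle_tm) : Type :=
  (tm_state M * {ffun tm_tapes M -> tape (tm_aux M)})%type.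

Definition init (M : oracle_tm) (x : str) : config M :=
  (tm_start M, [ffun t => if t == tm_io M then str_tape _ x else ([::], [::])]).

Definition step (M : oracle_tm) (B : set str) (c : config M) : config M :=
  match tm_prog c.1 with
  | Halt => c
  | Query yes no =>
      (if tape_str (c.2 (tm_query M)) \in B then yes else no, c.2)
  | Move delta =>
      let a := delta [ffun t => scanned (c.2 t)] in
      (a.1, [ffun t => write_move (a.2 t) (c.2 t)])
  end.

(* The configuration of [M] with oracle [B] on input [x] after [n] steps. *)
Definition run (M : oracle_tm) (B : set str) (x : str) (n : nat) : config M :=
  iter n (step B) (init M x).

Definition is_halt (state tapes aux : finType) (a : action state tapes aux) :=
  if a is Halt then true else false.

Definition is_query (state tapes aux : finType) (a : action state tapes aux) :=
  if a is Query _ _ then true else false.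

Definition halts_with (M : oracle_tm) (B : set str) (x y : str) : Prop :=
  exists n, let c := run M B x n in
    is_halt (tm_prog c.1) /\ tape_str (c.2 (tm_io M)) = y.

Definition queries (M : oracle_tm) (B : set str) (x q : str) : Prop :=
  exists n, let c := run M B x n in
    is_query (tm_prog c.1) /\ tape_str (c.2 (tm_query M)) = q.

(* An ordinary Turing machine; its runs do not depend on the oracle. *)
Definition query_free (M : oracle_tm) : Prop :=
  forall q : tm_state M, ~~ is_query (tm_prog q).

(* [None] stands for "undefined". *)
Definition partial_recursive (F : str -> option str) : Prop :=
  exists2 M, query_free M &
    forall x y, F x = Some y <-> halts_with M set0 x y.

(* Naturals are coded in unary. *)
Definition total_recursive (f : nat -> nat) : Prop :=
  exists2 M, query_free M &
    forall n, halts_with M set0 (nseq n true) (nseq (f n) true).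

Definition order_function (f : nat -> nat) : Prop :=
  [/\ {homo f : m n / (m <= n)%N}, total_recursive f & f @ \oo --> \oo].

Definition turing_reducible_via (M : oracle_tm) (A B : set str) : Prop :=
  forall x, halts_with M B x [:: x \in A].

Definition reducible_in_query_size (f : nat -> nat) (A B : set str) : Prop :=
  exists2 M, turing_reducible_via M A B &
    forall x q, queries M B x q -> (size q <= f (size x))%N.

Definition dom (F : str -> option str) : set str := [set p | F p != None].

Definition prefix_free (D : set str) : Prop :=
  forall p q, D p -> D q -> prefix p q -> p = q.

Definition prefix_free_machine (F : str -> option str) : Prop :=
  partial_recursive F /\ prefix_free (dom F).

Definition optimal (V : str -> option str) : Prop :=
  prefix_free_machine V /\
  forall F, prefix_free_machine F ->
    exists d : nat, forall p, dom F p ->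
      exists q, [/\ dom V q, V q = F p & (size q <= size p + d)%N].

(* The sum is at most 1 for prefix-free [dom V], so [fine] loses nothing. *)
Definition Omega (R : realType) (V : str -> option str) : R :=
  fine (\esum_(p in dom V) (2^-1 ^+ size p)%:E).

(* [b k] is the bit of weight 2^-(k+1). *)
Definition is_binary_expansion (R : realType) (a : R) (b : nat -> bool) :
    Prop :=
  series (fun k => (b k)%:R / 2 ^+ k.+1 : R) @ \oo
    --> a - (Num.floor a)%:~R /\
  (forall n, exists2 m, (n <= m)%N & b m = false).

(* [is_binary_expansion a] always holds of exactly one [b]. *)
Definition binary_expansion (R : realType) (a : R) : nat -> bool :=
  get (is_binary_expansion a).

Definition bit_prefix (R : realType) (a : R) (n : nat) : str :=
  mkseq (binary_expansion a) n.

Definition Pf (R : realType) (a : R) : set str := range (bit_prefix a).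

(* Main.v *)
Require Import Defs.
From HB Require Import structures.
From mathcomp Require Import all_boot all_order all_algebra.
From mathcomp Require Import all_classical all_reals all_analysis.
From mathcomp Require Import zify lra.
Set Implicit Arguments.
Unset Strict Implicit.
Unset Printing Implicit Defensive.
Import Order.TTheory GRing.Theory Num.Theory numFieldNormedType.Exports.

(** Write [l n = f n + c].  Both directions use that an optimal machine can be
    forced: whatever a prefix-free machine does on a program [q], [V] does on a
    program that is at most a constant [d] longer ([optimal_search]).  If what is
    printed on [q] at stage [t] is longer than everything [V] has printed by that
    stage, the program of [V] must be new, so that [Omega] exceeds its
    approximation at stage [t] by at least [2 ^- (size q + d)] ([kick]).  For instance,
    [Omega] cannot be dyadic, since one could push it beyond a known dyadic value
    once it is almost reached ([Omega_nondyadic]).  Therefore each of its digits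
    is eventually correct in the approximations from below ([flo_tf]).

    Suppose the sum is finite ([reducible_of_summable]).  By Kraft's inequality
    there is room for [2 ^ n] codewords of length [l n] for all [n] at once, and
    since [l] is non-decreasing they can be allotted one after the other in
    lexicographic order.  The [i]-th codeword for [n] halts when the
    approximation of the first [n] digits has reached [i], and prints the stage.
    As [W] does the same at the cost of a constant, a stage at which the first [n]
    digits are correct is found by asking which programs up to length [l n + d] are
    in [dom W], running these, and adding up the lengths of their outputs.

    Conversely, suppose there is a reduction and the sum diverges
    ([summable_of_reducible]).  For a budget [e], let [N] be so large that the sum
    of the [2 ^ n / 2 ^ l n] for [n <= N] exceeds [2 ^ (2 * e + 3)].  A machine
    with [2 ^ (N - 2 * e - 1)] programs of equal length pushes [Omega] by
    [2 ^- N] whenever the reduction, run with the current approximation of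
    [dom W], agrees with the current first [N] digits of [Omega] and a multiple of
    [2 ^- N] has been passed since the last push.  When [e] is the constant of
    [V], all these pushes take place ([all_kicks_happen]).  On inputs of length
    [n] the reduction depends only on the strings of length at most [l n] in its
    oracle, so whenever the first [n] digits change between pushes, such a string
    must have entered [dom W] ([kicks_count]).  This makes about
    [2 ^ (n - 2 * e - 1)] programs of length at most [l n], for every [n <= N], too
    many for Kraft's inequality for [dom W] ([kraft_count]).

    The machines themselves come from a structured language of bit stacks that
    compiles to Turing machines ([compile_exec]).  Binary trees, coded on one of
    the stacks, represent data, and the functions computed on such data are closed
    under folds, search and the step-bounded simulation of a Turing machine
    ([comp_out]); [search_machine] and [oracle_machine] turn them into partial
    recursive functions and reductions. *)

Local Open Scope nat_scope.

(** * A structured language of bit stacks, compiled to Turing machines *)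

Inductive tp := TA | TB | TC | TD | TQ | TIO.

Definition tp_code (t : tp) : bool * bool * bool :=
  match t with
  | TA => (false, false, false)
  | TB => (false, false, true)
  | TC => (false, true, false)
  | TD => (false, true, true)
  | TQ => (true, false, false)
  | TIO => (true, false, true)
  end.

Definition tp_decode (c : bool * bool * bool) : tp :=
  match c with
  | (false, false, false) => TA
  | (false, false, true) => TB
  | (false, true, false) => TC
  | (false, true, true) => TD
  | (true, _, false) => TQ
  | (true, _, true) => TIO
  end.

Lemma tp_codeK : cancel tp_code tp_decode. Proof. by case. Qed.

HB.instance Definition _ := Finite.copy tp (can_type tp_codeK).

Definition store := tp -> seq bool.

Definition upd (s : store) (t : tp) (v : seq bool) : store :=
  fun t' => if t' == t then v else s t'.

Inductive cmd :=
| Skip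
| Push of tp & bool
| Pop of tp & cmd & cmd & cmd
| Seq of cmd & cmd
| While of tp & cmd
| Ask of cmd & cmd.

(** [Q] holds of every string about which the oracle [B] is asked, so that a
    bound on the queries is part of the big-step semantics. *)
Inductive exec (B : set str) (Q : str -> Prop) : cmd -> store -> store -> Prop :=
| ESkip s : exec B Q Skip s s
| EPush t b s : exec B Q (Push t b) s (upd s t (b :: s t))
| EPopE t cE c0 c1 s s' : s t = [::] -> exec B Q cE s s' ->
    exec B Q (Pop t cE c0 c1) s s'
| EPop t cE c0 c1 b r s s' : s t = b :: r ->
    exec B Q (if b then c1 else c0) (upd s t r) s' ->
    exec B Q (Pop t cE c0 c1) s s'
| ESeq c1 c2 s s' s'' : exec B Q c1 s s' -> exec B Q c2 s' s'' ->
    exec B Q (Seq c1 c2) s s''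
| EWhileE t c s : s t = [::] -> exec B Q (While t c) s s
| EWhile t c s s' s'' : s t <> [::] -> exec B Q c s s' ->
    exec B Q (While t c) s' s'' -> exec B Q (While t c) s s''
| EAsk c0 c1 s s' : Q (s TQ) ->
    exec B Q (if s TQ \in B then c1 else c0) s s' ->
    exec B Q (Ask c0 c1) s s'.

Fixpoint noask (c : cmd) : bool :=
  match c with
  | Skip | Push _ _ => true
  | Pop _ a b c => [&& noask a, noask b & noask c]
  | Seq a b => noask a && noask b
  | While _ a => noask a
  | Ask _ _ => false
  end.

Inductive instr :=
| IPush of tp & bool & nat
| IPop of tp & nat & nat & nat
| ITest of tp & nat & nat
| IAsk of nat & nat
| IHalt.

Fixpoint csize (c : cmd) : nat :=
  match c with
  | Skip | Push _ _ => 1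
  | Pop _ a b c => (csize a + csize b + csize c).+1
  | Seq a b => csize a + csize b
  | While _ a => (csize a).+1
  | Ask a b => (csize a + csize b).+1
  end.

Fixpoint compile (c : cmd) (l nx : nat) : seq instr :=
  match c with
  | Skip => [:: ITest TA nx nx]
  | Push t b => [:: IPush t b nx]
  | Pop t cE c0 c1 =>
      let l0 := l.+1 + csize cE in let l1 := l0 + csize c0 in
      IPop t l.+1 l0 l1 ::
        compile cE l.+1 nx ++ compile c0 l0 nx ++ compile c1 l1 nx
  | Seq a b => compile a l (l + csize a) ++ compile b (l + csize a) nx
  | While t a => ITest t nx l.+1 :: compile a l.+1 l
  | Ask c0 c1 =>
      IAsk (l.+1 + csize c0) l.+1 ::
        compile c0 l.+1 nx ++ compile c1 (l.+1 + csize c0) nx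
  end.

Lemma size_compile c l nx : size (compile c l nx) = csize c.
Proof.
elim: c l nx => //= [t a Ha b Hb c Hc|a Ha b Hb|t a Ha|a Ha b Hb] l nx;
  by rewrite ?size_cat ?Ha ?Hb ?Hc ?addnA.
Qed.

(** The head of a tape rests on the top of its stack.  This is how inputs,
    outputs and queries are laid out, and blanks to either side are immaterial. *)
Definition trep (t : tape void) (s : seq bool) : Prop :=
  all (pred1 None) t.1 /\
  exists j, t.2 = [seq Some (inl b) | b <- s] ++ nseq j None.

Lemma trep_scanned t s : trep t s ->
  scanned t = if s is b :: _ then Some (inl b) else None.
Proof. by case: t => l r [_ [j /= ->]]; case: s => //=; case: j. Qed.

Lemma trep_str t s : trep t s -> tape_str t = s.
Proof.
case: t => l r [_ [j /= ->]]; rewrite /tape_str /=.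
by elim: s => /= [|b s ->] //; case: j.
Qed.

Lemma trep_stay t s : trep t s -> trep (write_move (scanned t, Stay) t) s.
Proof.
case: t => l r [hl [j /= ->]]; split=> //=.
case: s => [|b s] /=; last by exists j.
by case: j => [|j]; [exists 1 | exists j.+1].
Qed.

Lemma trep_push t s b : trep t s ->
  trep (write_move (Some (inl b), Stay) (write_move (scanned t, Left) t)) (b :: s).
Proof.
case: t => l r [hl [j /= ->]]; split=> /=.
  by case: l hl => //= ? ? /andP[].
case: s => [|c s] /=; last by exists j.
by case: j => [|j]; [exists 1 | exists j.+1].
Qed.

Lemma trep_pop t s b : trep t (b :: s) -> trep (write_move (None, Right) t) s.
Proof. by case: t => l r [hl [j /= ->]]; split=> //=; exists j. Qed.

Section Machine.
Variable code : seq instr.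
Let N := size code.

(** The boolean marks the second half of a push, which first moves left and then
    writes. *)
Definition mstate : finType := ('I_N.+1 * bool)%type.
Definition lbl (n : nat) : mstate := (inord n, false).
Definition keep (a : {ffun tp -> symbol void}) (t : tp) : symbol void * dir :=
  (a t, Stay).

Definition mprog (q : mstate) : action mstate tp void :=
  match nth IHalt code q.1 with
  | IHalt => @Halt _ _ _
  | IPush t b n => Move (fun a =>
      if q.2 then (lbl n, fun t' => if t' == t then (Some (inl b), Stay) else keep a t')
      else ((q.1, true), fun t' => if t' == t then (a t', Left) else keep a t'))
  | IPop t nE n0 n1 => Move (fun a =>
      if a t is Some (inl b) then
        (lbl (if b then n1 else n0), fun t' => if t' == t then (None, Right) else keep a t')
      else (lbl nE, keep a))
  | ITest t nE nN => Move (fun a =>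
      (lbl (if a t is Some (inl _) then nN else nE), keep a))
  | IAsk n1 n0 => @Query _ _ _ (lbl n1) (lbl n0)
  end.

Definition machine : oracle_tm := OracleTM (lbl 0) TIO TQ mprog.

Local Notation mstep := (@step machine).

Definition crep (c : config machine) (s : store) : Prop :=
  forall t, trep (c.2 t) (s t).

Definition reach (B : set str) (Q : str -> Prop) n (c c' : config machine) : Prop :=
  iter n (mstep B) c = c' /\
  forall k, k < n -> is_query (tm_prog (iter k (mstep B) c).1) ->
    Q (tape_str ((iter k (mstep B) c).2 (tm_query machine))).

Lemma reach_trans B Q n m c c' c'' :
  reach B Q n c c' -> reach B Q m c' c'' -> reach B Q (n + m) c c''.
Proof.
move=> [<- h1] [<- h2]; split; first by rewrite addnC iterD.
move=> k kl; case: (ltnP k n) => kn; first exact: h1.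
have -> : k = (k - n) + n by rewrite subnK.
by rewrite iterD; apply: h2; rewrite ltn_subLR.
Qed.

Lemma reach1 B (Q : str -> Prop) (c : config machine) :
  (is_query (tm_prog c.1) -> Q (tape_str (c.2 (tm_query machine)))) ->
  reach B Q 1 c (mstep B c).
Proof. by move=> h; split=> // -[]. Qed.

(** At least one step is taken, so that running through a loop again and again
    amounts to not halting. *)
Definition goes B Q (l l' : nat) (s s' : store) : Prop :=
  forall c, c.1 = lbl l -> crep c s ->
  exists n c', [/\ 0 < n, reach B Q n c c', c'.1 = lbl l' & crep c' s'].

Lemma goes_trans B Q l l' l'' s s' s'' :
  goes B Q l l' s s' -> goes B Q l' l'' s' s'' -> goes B Q l l'' s s''.
Proof.
move=> h1 h2 c cl cs; have [n [c' [n0 r1 l1 s1]]] := h1 c cl cs.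
have [m [c'' [m0 r2 l2 s2]]] := h2 c' l1 s1.
by exists (n + m), c''; split=> //; [rewrite addn_gt0 n0 | exact: reach_trans r2].
Qed.

Definition instr_at l i := nth IHalt code l = i /\ l < N.

Lemma lblK l : l < N -> ((lbl l).1 : nat) = l.
Proof. by move=> h; rewrite /lbl /= inordK // ltnS ltnW. Qed.

Lemma crep_keep (c : config machine) s (t : tp) (a : symbol void * dir) v q :
  crep c s -> trep (write_move a (c.2 t)) v ->
  crep (q, [ffun t' => write_move (if t' == t then a
    else keep [ffun t => scanned (c.2 t)] t') (c.2 t')]) (upd s t v).
Proof.
move=> cs tv t' /=; rewrite ffunE /upd; case: eqP => [->//|_].
by rewrite /keep ffunE; apply: trep_stay.
Qed.

Lemma crep_keepall (c : config machine) s q :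
  crep c s ->
  crep (q, [ffun t' => write_move (keep [ffun t => scanned (c.2 t)] t') (c.2 t')]) s.
Proof. by move=> cs t' /=; rewrite ffunE /keep ffunE; apply: trep_stay. Qed.

Lemma goes_test B Q l t nE nN s : instr_at l (ITest t nE nN) ->
  goes B Q l (if s t is _ :: _ then nN else nE) s s.
Proof.
move=> hl c cl cs; exists 1, (mstep B c).
have [h1 h2] := hl.
have e : @tm_prog machine c.1 = Move (fun a : {ffun tp -> symbol void} =>
      (lbl (if a t is Some (inl _) then nN else nE), keep a)).
  by rewrite /= cl /mprog lblK // h1.
split=> //; first by apply: reach1; rewrite e.
  rewrite /step e /= ffunE (trep_scanned (cs t)).
  by case: (s t).
by rewrite /step e /=; apply: crep_keepall.
Qed.

Lemma goes_ask B (Q : str -> Prop) l n1 n0 s : instr_at l (IAsk n1 n0) -> Q (s TQ) ->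
  goes B Q l (if s TQ \in B then n1 else n0) s s.
Proof.
move=> hl hQ c cl cs; exists 1, (mstep B c).
have [h1 h2] := hl.
have e : @tm_prog machine c.1 = @Query mstate tp void (lbl n1) (lbl n0).
  by rewrite /= cl /mprog lblK // h1.
split=> //.
- by apply: reach1 => _ /=; rewrite (trep_str (cs TQ)).
- by rewrite /step e /= (trep_str (cs TQ)); case: ifP.
- by rewrite /step e.
Qed.

Lemma goes_pop B Q l t nE n0 n1 s : instr_at l (IPop t nE n0 n1) ->
  if s t is b :: r then goes B Q l (if b then n1 else n0) s (upd s t r)
  else goes B Q l nE s s.
Proof.
move=> hl; have [h1 h2] := hl.
have e (c : config machine) (cl : c.1 = lbl l) :
    @tm_prog machine c.1 = Move (fun a : {ffun tp -> symbol void} =>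
      if a t is Some (inl b) then
        (lbl (if b then n1 else n0), fun t' => if t' == t then (None, Right) else keep a t')
      else (lbl nE, keep a)).
  by rewrite /= cl /mprog lblK // h1.
case est : (s t) => [|b r] c cl cs; exists 1, (mstep B c).
- split=> //; first by apply: reach1; rewrite e.
  + by rewrite /step e //= ffunE (trep_scanned (cs t)) est.
  + rewrite /step e //= ffunE (trep_scanned (cs t)) est /=.
    exact: crep_keepall.
- split=> //; first by apply: reach1; rewrite e.
  + by rewrite /step e //= ffunE (trep_scanned (cs t)) est.
  + rewrite /step e //= ffunE (trep_scanned (cs t)) est /=.
    by apply: crep_keep => //; apply: (@trep_pop _ _ b); rewrite -est.
Qed.

Lemma goes_push B Q l t b nx s : instr_at l (IPush t b nx) ->
  goes B Q l nx s (upd s t (b :: s t)).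
Proof.
move=> [h1 h2] c cl cs; exists 2, (mstep B (mstep B c)).
have e : @tm_prog machine c.1 = Move (fun a : {ffun tp -> symbol void} =>
   (((lbl l).1, true) : mstate, fun t' => if t' == t then (a t', Left) else keep a t')).
  by rewrite /= cl /mprog lblK // h1.
have e' : @tm_prog machine (mstep B c).1 = Move (fun a : {ffun tp -> symbol void} =>
   (lbl nx, fun t' => if t' == t then (Some (inl b), Stay) else keep a t')).
  by rewrite {1}/step e /= /mprog lblK // h1.
split=> //.
- apply: (@reach_trans _ _ 1 1 _ (mstep B c)); apply: reach1.
    by rewrite e.
  by rewrite e'.
- by rewrite {1}/step e'.
- move=> t'; rewrite {1}/step e' /= ffunE /upd; case: eqP => [->|ne].
    rewrite {1}/step e /= ffunE eqxx ffunE.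
    exact: trep_push.
  rewrite /keep ffunE; apply: trep_stay.
  rewrite /step e /= ffunE; case: eqP => // _.
  by rewrite /keep ffunE; apply: trep_stay.
Qed.

Definition code_at l (cs : seq instr) : Prop :=
  exists pre post, code = pre ++ cs ++ post /\ size pre = l.

Lemma code_at_cat l a b :
  code_at l (a ++ b) -> code_at l a /\ code_at (l + size a) b.
Proof.
move=> [pre [post [e <-]]]; split.
  by exists pre, (b ++ post); rewrite e !catA.
by exists (pre ++ a), post; rewrite e size_cat -!catA.
Qed.

Lemma code_at_cons l a b :
  code_at l (a :: b) -> instr_at l a /\ code_at l.+1 b.
Proof.
move=> h; have [h1 h2] := @code_at_cat l [:: a] b h.
split; last by rewrite -addn1.
case: h1 => pre [post [e <-]]; split; first by rewrite e nth_cat ltnn subnn.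
by rewrite /N e !size_cat /= -addSnnS leq_addr.
Qed.

(** By induction on the execution: every command leaves its block of code at the
    label that it was compiled to continue with. *)
Lemma compile_exec B Q c s s' : exec B Q c s s' ->
  forall l nx, code_at l (compile c l nx) -> goes B Q l nx s s'.
Proof.
elim=> {c s s'} /=.
- move=> s l nx /code_at_cons[h _].
  by have := @goes_test B Q _ _ _ _ s h; case: (s TA) => [|? ?]; apply.
- by move=> t b s l nx /code_at_cons[h _]; apply: goes_push.
- move=> t cE c0 c1 s s' est _ IH l nx /code_at_cons[h /code_at_cat[h1 _]].
  have := @goes_pop B Q _ _ _ _ _ s h; rewrite est => /goes_trans; apply.
  exact: IH.
- move=> t cE c0 c1 b r s s' est _ IH l nx.
  move=> /code_at_cons[h /code_at_cat[_ /code_at_cat[]]].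
  rewrite !size_compile => h0 h1.
  have := @goes_pop B Q _ _ _ _ _ s h; rewrite est => /goes_trans; apply.
  by apply: IH; case: (b).
- move=> c1 c2 s s' s'' _ IH1 _ IH2 l nx /code_at_cat[].
  rewrite size_compile => h1 h2.
  by apply: goes_trans; [apply: IH1 h1 | apply: IH2].
- move=> t c s est l nx /code_at_cons[h _].
  by have := @goes_test B Q _ _ _ _ s h; rewrite est.
- move=> t c s s' s'' est _ IH1 _ IH2 l nx hc.
  have /code_at_cons[h h1] := hc.
  have := @goes_test B Q _ _ _ _ s h.
  case: (s t) est => [/(_ erefl)//|b r _ /goes_trans]; apply.
  by apply: goes_trans; [exact: IH1 h1 | exact: IH2 hc].
- move=> c0 c1 s s' hQ _ IH l nx /code_at_cons[h /code_at_cat[h0 h1]].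
  rewrite size_compile in h1.
  apply: goes_trans; first exact: goes_ask h hQ.
  by apply: IH; case: ifP.
Qed.

(** An invariant under which the body of the loop leaves the tested stack
    nonempty keeps the machine running forever. *)
Lemma compile_while_div B Q t c (I : store -> Prop) l nx s cf :
  (forall s, I s -> s t <> [::] /\ exists2 s', exec B Q c s s' & I s') ->
  code_at l (compile (While t c) l nx) -> cf.1 = lbl l -> crep cf s -> I s ->
  forall k, exists n, k <= n /\ (iter n (mstep B) cf).1 = lbl l.
Proof.
move=> hI hc cl cs Is k.
have /code_at_cons[h h1] := hc.
suff [n [c' [s' [kn [<- _] c'l c's Is']]]] : exists n c' s',
    [/\ k <= n, reach B Q n cf c', c'.1 = lbl l, crep c' s' & I s'].
  by exists n.
elim: k => [|k [n [c' [s' [kn r c'l c's Is']]]]].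
  by exists 0, cf, s; split.
have [ne [s'' ex Is'']] := hI _ Is'.
have gt := @goes_test B Q _ _ _ _ s' h.
have gs : goes B Q l l s' s''.
  case: (s' t) ne gt => [/(_ erefl)//|b r' _ /goes_trans]; apply.
  exact: compile_exec ex _ _ h1.
have [m [c'' [m0 r2 l2 s2]]] := gs _ c'l c's.
exists (n + m), c'', s''; split=> //; last exact: reach_trans r2.
by rewrite -addn1 leq_add.
Qed.

End Machine.

(** * Whole programs as oracle machines *)

Definition st a b c d q io : store := fun t =>
  match t with
  | TA => a | TB => b | TC => c | TD => d | TQ => q | TIO => io
  end.

Lemma updA a b c d q io v : upd (st a b c d q io) TA v = st v b c d q io.
Proof. by apply: funext; case. Qed.
Lemma updB a b c d q io v : upd (st a b c d q io) TB v = st a v c d q io.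
Proof. by apply: funext; case. Qed.
Lemma updC a b c d q io v : upd (st a b c d q io) TC v = st a b v d q io.
Proof. by apply: funext; case. Qed.
Lemma updD a b c d q io v : upd (st a b c d q io) TD v = st a b c v q io.
Proof. by apply: funext; case. Qed.
Lemma updQ a b c d q io v : upd (st a b c d q io) TQ v = st a b c d v io.
Proof. by apply: funext; case. Qed.
Lemma updIO a b c d q io v : upd (st a b c d q io) TIO v = st a b c d q v.
Proof. by apply: funext; case. Qed.
Definition updE := (updA, updB, updC, updD, updQ, updIO).

Lemma step_halted M B (c : config M) n :
  is_halt (tm_prog c.1) -> iter n (step B) c = c.
Proof.
move=> h; elim: n => //= n ->; rewrite /step.
by case: (tm_prog c.1) h.
Qed.

Lemma halts_with_inj M B x y y' :
  halts_with M B x y -> halts_with M B x y' -> y = y'.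
Proof.
move=> [n [h <-]] [m [h' <-]].
have e k l (hl : is_halt (tm_prog (run M B x k).1)) : k <= l ->
    run M B x l = run M B x k.
  by move=> /subnK <-; rewrite /run iterD step_halted.
by case: (leqP n m) => [/(e _ _ h) -> //|/ltnW/(e _ _ h') ->].
Qed.

Definition program (c : cmd) : oracle_tm := machine (compile c 0 (csize c)).

Lemma code_at_program c : code_at (compile c 0 (csize c)) 0 (compile c 0 (csize c)).
Proof. by exists [::], [::]; rewrite cats0. Qed.

Lemma init_crep c x :
  @crep (compile c 0 (csize c)) (init (program c) x) (st [::] [::] [::] [::] [::] x).
Proof.
move=> t; rewrite /init /= ffunE.
case: t => /=; split => //; try by exists 0.
by exists 0; rewrite cats0.
Qed.

(** The label past the end of the code is a halting state, and a halted machine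
    asks nothing more, so all queries are those of the execution. *)
Lemma program_exec c B (Q : str -> Prop) x s' :
  exec B Q c (st [::] [::] [::] [::] [::] x) s' ->
  halts_with (program c) B x (s' TIO) /\
  forall q, queries (program c) B x q -> Q q.
Proof.
move=> ex; have /(_ (init (program c) x) erefl (@init_crep c x)) :=
  compile_exec ex (code_at_program c).
move=> [n [c' [n0 [r rq] c'l c's]]].
have hc' : is_halt (tm_prog c'.1).
  rewrite c'l /= /mprog.
  have -> : ((lbl (compile c 0 (csize c)) (csize c)).1 : nat) = csize c.
    by rewrite /lbl /= inordK // size_compile.
  by rewrite nth_default // size_compile.
split.
  by exists n; rewrite /run r; split=> //; apply: trep_str; exact: c's.
move=> q [m]; rewrite /run; case: (ltnP m n) => mn /= [iq <-].
  exact: rq.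
move: iq; rewrite -(subnK mn) iterD r step_halted //.
by move: hc' => /=; case: (mprog _).
Qed.

(** A machine that halts stays where it is, whereas the loop comes back to its
    test, which is not a halting state, after arbitrarily many steps. *)
Lemma program_div c1 t c2 c3 B Q x (I : store -> Prop) s :
  let c := Seq c1 (Seq (While t c2) c3) in
  exec B Q c1 (st [::] [::] [::] [::] [::] x) s -> I s ->
  (forall s, I s -> s t <> [::] /\ exists2 s', exec B Q c2 s s' & I s') ->
  forall y, ~ halts_with (program c) B x y.
Proof.
move=> c ex Is hI y [m []]; rewrite /run => hm _.
have /code_at_cat[h1] := code_at_program c.
rewrite size_compile => /code_at_cat[h2 _].
have /(_ (init (program c) x) erefl (@init_crep c x)) := compile_exec ex h1.
move=> [n [c' [n0 [r _] c'l c's]]].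
have [k [mk kl]] := @compile_while_div _ B Q t c2 I _ _ s c' hI h2 c'l c's Is m.
have e : iter (k + n) (step B) (init (program c) x) =
         iter m (step B) (init (program c) x).
  have -> : k + n = (k + n - m) + m by rewrite subnK // (leq_trans mk) ?leq_addr.
  by rewrite iterD step_halted.
have /code_at_cons[[hi hl] _] := h2.
move: hm; rewrite -e iterD r kl /= /mprog lblK ?size_compile //.
  by rewrite hi.
Qed.

Lemma program_query_free c : noask c -> query_free (program c).
Proof.
move=> nc q; rewrite /= /mprog.
have : all (fun i => if i is IAsk _ _ then false else true) (compile c 0 (csize c)).
  move: (csize c) 0 => nx l; elim: c nc l nx {q} => //=.
  - move=> t a Ha b Hb c Hc /and3P[na nb nc] l nx.
    by rewrite !all_cat Ha // Hb // Hc.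
  - by move=> a Ha b Hb /andP[na nb] l nx; rewrite !all_cat Ha // Hb.
  - by move=> _ a Ha na l nx; rewrite Ha.
move=> /all_nthP => /(_ IHalt (q.1 : nat)).
case: (ltnP q.1 (size (compile c 0 (csize c)))) => [lt /(_ isT)|ge _].
  by case: (nth _ _ _).
by rewrite nth_default.
Qed.

(** * Binary trees on the working stack *)

Inductive tree := Leaf | Node of tree & tree.

Definition isnode t := if t is Node _ _ then true else false.
Definition thd t := if t is Node a _ then a else Leaf.
Definition ttl t := if t is Node _ b then b else Leaf.

(** A prefix code: the topmost of several trees on a stack can be told apart from
    the rest, and a node becomes two trees when its first bit is popped. *)
Fixpoint code (t : tree) : seq bool :=
  if t is Node a b then true :: code a ++ code b else [:: false].

Definition codes ts := flatten (map code ts).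

Notation "c1 ;; c2" := (Seq c1 c2) (at level 60, right associativity).

Definition pushes (fb fc b : bool) : cmd :=
  (if fb then Push TB b else Skip) ;; (if fc then Push TC b else Skip).

(** The stack [TD] counts the trees still to be read: a leaf closes one, and a
    node replaces one by two. *)
Definition xbody fb fc : cmd :=
  Pop TD Skip Skip
    (Pop TA Skip (pushes fb fc false)
       (pushes fb fc true ;; Push TD true ;; Push TD true)).

Definition xfer fb fc : cmd := Push TD true ;; While TD (xbody fb fc).

Definition back t : cmd := While t (Pop t Skip (Push TA false) (Push TA true)).

Definition drop_top : cmd := xfer false false.
Definition dup_top : cmd := xfer true true ;; back TB ;; back TC.
Definition swap_top : cmd := xfer true false ;; xfer false true ;; back TB ;; back TC.

Section Exec.
Variables (B : set str) (Q : str -> Prop).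
Local Notation ex := (exec B Q).

Lemma ex_push t b s s' : upd s t (b :: s t) = s' -> ex (Push t b) s s'.
Proof. by move=> <-; apply: EPush. Qed.

Lemma ex_pushes fb fc b x y z d q io :
  ex (pushes fb fc b) (st x y z d q io)
     (st x (if fb then b :: y else y) (if fc then b :: z else z) d q io).
Proof.
apply: (@ESeq _ _ _ _ _ (st x (if fb then b :: y else y) z d q io)).
  by case: fb; [apply: ex_push; rewrite updE | apply: ESkip].
by case: fc; [apply: ex_push; rewrite updE | apply: ESkip].
Qed.

Lemma ex_xloop fb fc ts s y z q io :
  ex (While TD (xbody fb fc))
     (st (codes ts ++ s) y z (nseq (size ts) true) q io)
     (st s (if fb then catrev (codes ts) y else y)
           (if fc then catrev (codes ts) z else z) [::] q io).
Proof.
move: {2}(size (codes ts)) (leqnn (size (codes ts))) => n.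
elim: n ts y z => [|n IH] [|[|l r] ts] y z //= hn;
  try by rewrite !if_same; apply: EWhileE.
- apply: EWhile => //.
    apply: (@EPop _ _ TD _ _ _ true (nseq (size ts) true)) => //.
    rewrite updE; apply: EPop => //=; rewrite updE; exact: ex_pushes.
  have {}IH := IH ts (if fb then false :: y else y) (if fc then false :: z else z) hn.
  by case: fb fc IH => -[].
- apply: EWhile => //.
    apply: (@EPop _ _ TD _ _ _ true (nseq (size ts) true)) => //.
    rewrite updE; apply: EPop => //=; rewrite updE.
    apply: ESeq; first exact: ex_pushes.
    apply: ESeq; first by apply: ex_push; rewrite updE.
    by apply: ex_push; rewrite updE.
  have {}IH := IH (l :: r :: ts) (if fb then true :: y else y)
     (if fc then true :: z else z).
  rewrite /codes /= -!catA /= in hn IH *.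
  by case: fb fc IH => -[] /(_ hn).
Qed.

Lemma ex_xfer fb fc t s y z q io :
  ex (xfer fb fc) (st (code t ++ s) y z [::] q io)
     (st s (if fb then catrev (code t) y else y)
           (if fc then catrev (code t) z else z) [::] q io).
Proof.
apply: ESeq; first by apply: ex_push; rewrite updE.
by have := ex_xloop fb fc [:: t] s y z q io; rewrite /codes /= cats0.
Qed.

Lemma ex_backB a b c d q io :
  ex (back TB) (st a b c d q io) (st (catrev b a) [::] c d q io).
Proof.
elim: b a => [|b r IH] a; first exact: EWhileE.
apply: EWhile => //; last exact: IH.
apply: EPop => //; rewrite updE.
by case: b; apply: ex_push; rewrite updE.
Qed.

Lemma ex_backC a b c d q io :
  ex (back TC) (st a b c d q io) (st (catrev c a) b [::] d q io).
Proof.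
elim: c a => [|x r IH] a; first exact: EWhileE.
apply: EWhile => //; last exact: IH.
apply: EPop => //; rewrite updE.
by case: x; apply: ex_push; rewrite updE.
Qed.

Local Notation S a io := (st a [::] [::] [::] [::] io).

Lemma catrevK (T : Type) (s t : seq T) : catrev (catrev s [::]) t = s ++ t.
Proof. by rewrite -/(rev s) catrevE revK. Qed.

Lemma ex_drop t s io : ex drop_top (S (code t ++ s) io) (S s io).
Proof. exact: ex_xfer. Qed.

Lemma ex_dup t s io :
  ex dup_top (S (code t ++ s) io) (S (code t ++ code t ++ s) io).
Proof.
apply: ESeq; first exact: ex_xfer.
apply: ESeq; first exact: ex_backB.
by rewrite catrevK -[code t ++ code t ++ s]catrevK; apply: ex_backC.
Qed.

Lemma ex_swap t u s io :
  ex swap_top (S (code t ++ code u ++ s) io) (S (code u ++ code t ++ s) io).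
Proof.
apply: ESeq; first exact: ex_xfer.
apply: ESeq; first exact: ex_xfer.
apply: ESeq; first exact: ex_backB.
by rewrite catrevK -[code u ++ code t ++ s]catrevK; apply: ex_backC.
Qed.

(** Whatever lies below the top tree is left alone, so that programs on the
    top tree compose. *)
Definition runs p u v := forall s io, ex p (S (code u ++ s) io) (S (code v ++ s) io).

Lemma runs_skip t : runs Skip t t.
Proof. by move=> s io; apply: ESkip. Qed.

Lemma runs_seq p q t u v : runs p t u -> runs q u v -> runs (p ;; q) t v.
Proof. by move=> h1 h2 s io; apply: ESeq; [apply: h1|apply: h2]. Qed.

Definition pair_prog p q := dup_top ;; q ;; swap_top ;; p ;; Push TA true.

Lemma runs_pair p q t u v : runs p t u -> runs q t v ->
  runs (pair_prog p q) t (Node u v).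
Proof.
move=> h1 h2 s io; apply: ESeq; first exact: ex_dup.
apply: ESeq; first exact: h2.
apply: ESeq; first exact: ex_swap.
apply: ESeq; first exact: h1.
by apply: ex_push; rewrite updE /= catA.
Qed.

Definition hd_prog := Pop TA Skip (Push TA false) (swap_top ;; drop_top).
Definition tl_prog := Pop TA Skip (Push TA false) drop_top.

Lemma runs_hd t : runs hd_prog t (thd t).
Proof.
case: t => [|t u] s io; apply: EPop => //=; rewrite updE.
  by apply: ex_push; rewrite updE.
by apply: ESeq; rewrite -?catA; [apply: ex_swap | apply: ex_drop].
Qed.

Lemma runs_tl t : runs tl_prog t (ttl t).
Proof.
case: t => [|t u] s io; apply: EPop => //=; rewrite updE.
  by apply: ex_push; rewrite updE.
rewrite -catA; exact: ex_drop.
Qed.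

Definition push_all w := foldr (fun b c => c ;; Push TA b) Skip w.
Definition const_prog t := drop_top ;; push_all (code t).

Lemma ex_push_all w a io : ex (push_all w) (S a io) (S (w ++ a) io).
Proof.
elim: w => [|b w IH] /=; first exact: ESkip.
by apply: ESeq; first exact: IH; apply: ex_push; rewrite updE.
Qed.

Lemma runs_const u t : runs (const_prog t) u t.
Proof.
by move=> s io; apply: ESeq; first exact: ex_drop; exact: ex_push_all.
Qed.

(** A condition that is a node leaves two trees behind when its first bit is
    popped; both have to go. *)
Definition if_prog pc p1 p0 :=
  dup_top ;; pc ;; Pop TA Skip p0 (drop_top ;; drop_top ;; p1).

Lemma runs_if pc p1 p0 t c v : runs pc t c ->
  (if isnode c then runs p1 t v else runs p0 t v) -> runs (if_prog pc p1 p0) t v.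
Proof.
move=> hc h s io; apply: ESeq; first exact: ex_dup.
apply: ESeq; first exact: hc.
case: c {hc} h => [|c c'] /= h; apply: EPop => //=; rewrite updE; first exact: h.
rewrite -catA; apply: ESeq; first exact: ex_drop.
by apply: ESeq; [apply: ex_drop | apply: h].
Qed.

(** The test happens inside the body, and one bit on [TD] tells the enclosing
    loop whether to go on. *)
Definition loop_body pc pb :=
  Pop TD Skip Skip
    (dup_top ;; pc ;;
     Pop TA Skip Skip (drop_top ;; drop_top ;; pb ;; Push TD true)).
Definition loop_prog pc pb := Push TD true ;; While TD (loop_body pc pb).

Local Notation SD a io := (st a [::] [::] [:: true] [::] io).

Lemma ex_loop_stop pc pb t c s io : runs pc t c -> ~~ isnode c ->
  ex (loop_body pc pb) (SD (code t ++ s) io) (S (code t ++ s) io).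
Proof.
move=> hc; case: c hc => // hc _.
apply: (@EPop _ _ TD _ _ _ true [::]) => //=; rewrite updE.
apply: ESeq; first exact: ex_dup.
apply: ESeq; first exact: hc.
by apply: EPop => //=; rewrite updE; apply: ESkip.
Qed.

Lemma ex_loop_go pc pb t c t' s io : runs pc t c -> isnode c -> runs pb t t' ->
  ex (loop_body pc pb) (SD (code t ++ s) io) (SD (code t' ++ s) io).
Proof.
move=> hc; case: c hc => // c c' hc _ hb.
apply: (@EPop _ _ TD _ _ _ true [::]) => //=; rewrite updE.
apply: ESeq; first exact: ex_dup.
apply: ESeq; first exact: hc.
apply: EPop => //=; rewrite updE -catA.
apply: ESeq; first exact: ex_drop.
apply: ESeq; first exact: ex_drop.
apply: ESeq; first exact: hb.
by apply: ex_push; rewrite updE.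
Qed.

Lemma ex_loop pc pb n (w c : nat -> tree) s io :
  (forall i, i <= n -> runs pc (w i) (c i) /\ isnode (c i) = (i < n)) ->
  (forall i, i < n -> runs pb (w i) (w i.+1)) ->
  ex (While TD (loop_body pc pb)) (SD (code (w 0) ++ s) io) (S (code (w n) ++ s) io).
Proof.
move=> hc hb.
have h i : i <= n -> ex (While TD (loop_body pc pb))
    (SD (code (w (n - i)) ++ s) io) (S (code (w n) ++ s) io).
  elim: i => [_|i IH lin].
    rewrite subn0; have [h1 h2] := hc n (leqnn n).
    apply: EWhile => //; first by apply: ex_loop_stop h1 _; rewrite h2 ltnn.
    exact: EWhileE.
  have lt : n - i.+1 < n by rewrite ltn_subrL (leq_ltn_trans _ lin).
  have [h1 h2] := hc (n - i.+1) (ltnW lt).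
  apply: EWhile => //; first by apply: ex_loop_go h1 _ (hb _ lt); rewrite h2.
  by rewrite -subSn // subSS; apply: IH; apply: ltnW.
by have := h n (leqnn n); rewrite subnn.
Qed.

Lemma runs_loop pc pb n (w c : nat -> tree) :
  (forall i, i <= n -> runs pc (w i) (c i) /\ isnode (c i) = (i < n)) ->
  (forall i, i < n -> runs pb (w i) (w i.+1)) ->
  runs (loop_prog pc pb) (w 0) (w n).
Proof.
move=> hc hb s io; apply: ESeq; first by apply: ex_push; rewrite updE.
exact: ex_loop hc hb.
Qed.

End Exec.

(** * Computable functions between encodable types *)

Class Enc (T : Type) := enc : T -> tree.

Fixpoint enc_nat n := if n is m.+1 then Node Leaf (enc_nat m) else Leaf.
Fixpoint enc_seq (T : Type) (e : Enc T) (l : seq T) :=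
  if l is a :: r then Node (e a) (enc_seq e r) else Leaf.

#[export] Instance Enc_nat : Enc nat := enc_nat.
#[export] Instance Enc_bool : Enc bool :=
  fun b => if b then Node Leaf Leaf else Leaf.
#[export] Instance Enc_seq T (e : Enc T) : Enc (seq T) := enc_seq e.
#[export] Instance Enc_prod T U (e : Enc T) (e' : Enc U) : Enc (T * U) :=
  fun p => Node (e p.1) (e' p.2).
#[export] Instance Enc_option T (e : Enc T) : Enc (option T) :=
  fun o => if o is Some a then Node (e a) Leaf else Leaf.

(** The program may not use the oracle, but it has to work next to any oracle, so
    that it can be part of an oracle program. *)
Definition computes X Y (eX : Enc X) (eY : Enc Y) p (f : X -> Y) : Prop :=
  noask p /\ forall B Q x, runs B Q p (enc x) (enc (f x)).

Definition comp X Y (eX : Enc X) (eY : Enc Y) (f : X -> Y) : Prop :=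
  exists p, computes eX eY p f.
Arguments comp {X Y eX eY} f.
Arguments computes {X Y eX eY} p f.

Section Basic.
Context {X Y Z : Type} {eX : Enc X} {eY : Enc Y} {eZ : Enc Z}.

Lemma comp_ext (f g : X -> Y) : f =1 g -> comp f -> comp g.
Proof. by move=> e [p [np h]]; exists p; split=> // B Q x; rewrite -e. Qed.

Lemma comp_id : comp (fun x : X => x).
Proof. by exists Skip; split=> // B Q x; apply: runs_skip. Qed.

Lemma comp_comp (g : Y -> Z) (f : X -> Y) : comp g -> comp f -> comp (fun x => g (f x)).
Proof.
move=> [p [np hp]] [q [nq hq]]; exists (q ;; p); split; first by rewrite /= nq np.
by move=> B Q x; apply: runs_seq; [apply: hq | apply: hp].
Qed.

Lemma comp_pair (f : X -> Y) (g : X -> Z) : comp f -> comp g -> comp (fun x => (f x, g x)).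
Proof.
move=> [p [np hp]] [q [nq hq]]; exists (pair_prog p q); split.
  by rewrite /= nq np.
by move=> B Q x; apply: runs_pair; [apply: hp | apply: hq].
Qed.

Lemma comp_fst (f : X -> Y * Z) : comp f -> comp (fun x => (f x).1).
Proof.
move=> [p [np hp]]; exists (p ;; hd_prog); split; first by rewrite /= np.
move=> B Q x; apply: runs_seq; first exact: hp.
exact: (runs_hd B Q (enc (f x))).
Qed.

Lemma comp_snd (f : X -> Y * Z) : comp f -> comp (fun x => (f x).2).
Proof.
move=> [p [np hp]]; exists (p ;; tl_prog); split; first by rewrite /= np.
move=> B Q x; apply: runs_seq; first exact: hp.
exact: (runs_tl B Q (enc (f x))).
Qed.

Lemma noask_push_all w : noask (push_all w).
Proof. by elim: w => //= b w ->. Qed.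

Lemma comp_const (y : Y) : comp (fun _ : X => y).
Proof.
exists (const_prog (enc y)); split; first by rewrite /= noask_push_all.
by move=> B Q x; apply: runs_const.
Qed.

Lemma comp_if (b : X -> bool) (f g : X -> Y) :
  comp b -> comp f -> comp g -> comp (fun x => if b x then f x else g x).
Proof.
move=> [p [np hp]] [q [nq hq]] [r [nr hr]]; exists (if_prog p q r); split.
  by rewrite /= np nq nr.
move=> B Q x; apply: runs_if; first exact: hp.
by case: (b x); [apply: hq | apply: hr].
Qed.

End Basic.

Lemma comp2 X A1 A2 Y {eX : Enc X} {e1 : Enc A1} {e2 : Enc A2} {eY : Enc Y}
    (h : A1 -> A2 -> Y) (f : X -> A1) (g : X -> A2) :
  comp (fun u : A1 * A2 => h u.1 u.2) -> comp f -> comp g ->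
  comp (fun x => h (f x) (g x)).
Proof.
move=> hh hf hg.
exact: (comp_comp (g := fun u => h u.1 u.2) hh (comp_pair hf hg)).
Qed.

Lemma comp3 X A1 A2 A3 Y {eX : Enc X} {e1 : Enc A1} {e2 : Enc A2} {e3 : Enc A3}
    {eY : Enc Y} (h : A1 -> A2 -> A3 -> Y) (f : X -> A1) (g : X -> A2) (k : X -> A3) :
  comp (fun u : A1 * A2 * A3 => h u.1.1 u.1.2 u.2) -> comp f -> comp g -> comp k ->
  comp (fun x => h (f x) (g x) (k x)).
Proof.
move=> hh hf hg hk.
exact: (comp_comp (g := fun u => h u.1.1 u.1.2 u.2) hh (comp_pair (comp_pair hf hg) hk)).
Qed.

(* [comp_prim] holds the closure lemmas of the primitives known so far. *)
Ltac comp_prim := fail.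

Ltac comp_step :=
  cbv beta delta [str];
  lazymatch goal with
  | |- @comp _ _ _ _ (fun x => x) => exact comp_id
  | |- @comp _ _ _ _ (fun _ => ?c) => exact (comp_const c)
  | |- @comp _ _ _ _ (fun x => (@?f x, @?g x)) => apply (comp_pair (f := f) (g := g))
  | |- @comp _ _ _ _ (fun x => (@?f x).1) => apply (comp_fst (f := f))
  | |- @comp _ _ _ _ (fun x => (@?f x).2) => apply (comp_snd (f := f))
  | |- @comp _ _ _ _ fst => apply (comp_fst comp_id)
  | |- @comp _ _ _ _ snd => apply (comp_snd comp_id)
  | |- _ => first
    [ assumption
    | simple eapply comp_if
    | comp_prim
    | match goal with
      | H : @comp _ _ _ _ ?m |- @comp _ _ _ _ (fun x => ?m (@?f x)) =>
          apply (comp_comp (g := m) (f := f) H)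
      | H : @comp _ _ _ _ (fun u => ?h u.1 u.2) |-
          @comp _ _ _ _ (fun x => ?h (@?f x) (@?g x)) =>
          apply (comp2 (h := h) (f := f) (g := g) H)
      | H : @comp _ _ _ _ (fun u => ?h u.1.1 u.1.2 u.2) |-
          @comp _ _ _ _ (fun x => ?h (@?f x) (@?g x) (@?k x)) =>
          apply (comp3 (h := h) (f := f) (g := g) (k := k) H)
      end ]
  end.

Ltac comp_tac := repeat comp_step.

(* Functions on trees that commute with the encodings. *)
Section TreeLevel.
Context {X Y : Type} {eX : Enc X} {eY : Enc Y}.

Lemma comp_tl (f : X -> Y) Z {eZ : Enc Z} (g : X -> Z) :
  (forall x, ttl (enc (g x)) = enc (f x)) -> comp g -> comp f.
Proof.
move=> e [p [np hp]]; exists (p ;; tl_prog); split; first by rewrite /= np.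
by move=> B Q x; rewrite -e; apply: runs_seq; [apply: hp | apply: runs_tl].
Qed.

Lemma comp_node (f : X -> Y) Z T {eZ : Enc Z} {eT : Enc T} (g : X -> Z) (h : X -> T) :
  (forall x, Node (enc (g x)) (enc (h x)) = enc (f x)) -> comp g -> comp h -> comp f.
Proof.
move=> e [p [np hp]] [q [nq hq]]; exists (pair_prog p q); split.
  by rewrite /= nq np.
by move=> B Q x; rewrite -e; apply: runs_pair; [apply: hp | apply: hq].
Qed.

Lemma comp_same (f : X -> Y) Z {eZ : Enc Z} (g : X -> Z) :
  (forall x, enc (g x) = enc (f x)) -> comp g -> comp f.
Proof. by move=> e [p [np h]]; exists p; split=> // B Q x; rewrite -e. Qed.

Lemma comp_isnode (f : X -> bool) Z {eZ : Enc Z} (g : X -> Z) :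
  (forall x, isnode (enc (g x)) = f x) -> comp g -> comp f.
Proof.
move=> e [p [np hp]].
exists (if_prog p (const_prog (enc true)) (const_prog (enc false))); split.
  by rewrite /= np.
move=> B Q x; apply: runs_if; first exact: hp.
by rewrite e; case: (f x); apply: runs_const.
Qed.

End TreeLevel.

Section Constructors.
Context {X Y : Type} {eX : Enc X} {eY : Enc Y}.
Implicit Types (n : X -> nat) (b : X -> bool).

Lemma comp_S n : comp n -> comp (fun x => (n x).+1).
Proof.
by apply: (comp_node (g := fun _ : X => false)) => //; apply: comp_const.
Qed.

Lemma comp_predn n : comp n -> comp (fun x => (n x).-1).
Proof. by apply: comp_tl => x; case: (n x). Qed.

Lemma comp_nat_gt0 n : comp n -> comp (fun x => 0 < n x).
Proof. by apply: comp_isnode => x; case: (n x). Qed.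

Lemma comp_natb b : comp b -> comp (fun x => (b x : nat)).
Proof. by apply: comp_same => x; case: (b x). Qed.

Lemma comp_cons (a : X -> Y) (l : X -> seq Y) :
  comp a -> comp l -> comp (fun x => a x :: l x).
Proof. exact: comp_node. Qed.

Lemma comp_behead (l : X -> seq Y) : comp l -> comp (fun x => behead (l x)).
Proof. by apply: comp_tl => x; case: (l x). Qed.

Lemma comp_isnil (l : X -> seq Y) : comp l -> comp (fun x => ~~ nilp (l x)).
Proof. by apply: comp_isnode => x; case: (l x). Qed.

Lemma comp_Some (a : X -> Y) : comp a -> comp (fun x => Some (a x)).
Proof.
by move=> h; apply: (comp_node (g := a) (h := fun _ => false)) => //; apply: comp_const.
Qed.

Lemma comp_isSome (o : X -> option Y) : comp o -> comp (fun x => isSome (o x)).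
Proof. by apply: comp_isnode => x; case: (o x). Qed.

Lemma comp_negb b : comp b -> comp (fun x => ~~ b x).
Proof.
move=> hb; apply: comp_ext (comp_if hb (comp_const false) (comp_const true)).
by move=> x; case: (b x).
Qed.

Lemma comp_andb b (c : X -> bool) : comp b -> comp c -> comp (fun x => b x && c x).
Proof. by move=> hb hc; exact: comp_if hb hc (comp_const false). Qed.

(** The defaults [y] are computed by a separate branch, so that they need not
   agree with what the head program leaves on the empty list. *)
Lemma comp_head (y : X -> Y) (l : X -> seq Y) :
  comp y -> comp l -> comp (fun x => head (y x) (l x)).
Proof.
move=> [p [np hp]] hl; have [q [nq hq]] := hl; have [r [nr hr]] := comp_isnil hl.
exists (if_prog r (q ;; hd_prog) p); split; first by rewrite /= np nq nr.
move=> B Q x; apply: runs_if; first exact: hr.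
have := hq B Q x; have := hp B Q x.
case: (l x) => //= a s _ h; apply: runs_seq; first exact: h.
exact: runs_hd.
Qed.

Lemma comp_odflt (y : X -> Y) (o : X -> option Y) :
  comp y -> comp o -> comp (fun x => odflt (y x) (o x)).
Proof.
move=> [p [np hp]] ho; have [q [nq hq]] := ho; have [r [nr hr]] := comp_isSome ho.
exists (if_prog r (q ;; hd_prog) p); split; first by rewrite /= np nq nr.
move=> B Q x; apply: runs_if; first exact: hr.
have := hq B Q x; have := hp B Q x.
case: (o x) => //= a _ h; apply: runs_seq; first exact: h.
exact: runs_hd.
Qed.

End Constructors.

Ltac comp_ctor := first
  [ simple eapply comp_S | simple eapply comp_predn | simple eapply comp_nat_gt0
  | simple eapply comp_natb | simple eapply comp_cons | simple eapply comp_behead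
  | simple eapply comp_isnil | simple eapply comp_Some | simple eapply comp_isSome
  | simple eapply comp_negb | simple eapply comp_andb
  | simple eapply comp_head | simple eapply comp_odflt ].

Ltac comp_prim ::= comp_ctor.

Definition fold_body pb :=
  pair_prog (hd_prog ;; tl_prog) (pair_prog (hd_prog ;; hd_prog) tl_prog ;; pb).
Definition fold_prog pb := loop_prog hd_prog (fold_body pb) ;; tl_prog.

(** The body is only required to work on the elements of the list, since with
    oracle questions in it not every element may be admissible. *)
Lemma runs_fold B Q X Z {eX : Enc X} {eZ : Enc Z} pb (h : Z -> X -> Z) z (l : seq X) :
  (forall i z', i < size l -> forall d,
     runs B Q pb (enc (nth d l i, z')) (enc (h z' (nth d l i)))) ->
  runs B Q (fold_prog pb) (enc (l, z)) (enc (foldl h z l)).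
Proof.
move=> hp.
pose (w := fun i => enc (drop i l, foldl h z (take i l))).
apply: (@runs_seq _ _ _ _ _ (enc (Nil X, foldl h z l))); last first.
  exact: (runs_tl B Q (enc ([::], foldl h z l))).
have -> : enc (l, z) = w 0 by rewrite /w drop0 take0.
have -> : enc (Nil X, foldl h z l) = w (size l) by rewrite /w drop_size take_size.
apply: (@runs_loop _ _ _ _ _ _ (fun i => enc (drop i l))) => i il.
  split; first exact: (runs_hd B Q (w i)).
  rewrite -subn_gt0 -size_drop; by case: (drop i l).
have [d dl] : exists d, drop i l = nth d l i :: drop i.+1 l.
  case: l il {hp w} => // d l il; exists d; exact: drop_nth.
have h0 : thd (w i) = enc (drop i l) by [].
have e1 : thd (thd (w i)) = enc (nth d l i) by rewrite h0 dl.
have e2 : ttl (thd (w i)) = enc (drop i.+1 l) by rewrite h0 dl.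
have e3 : ttl (w i) = enc (foldl h z (take i l)) by [].
have -> : w i.+1 = Node (enc (drop i.+1 l)) (enc (h (foldl h z (take i l)) (nth d l i))).
  by rewrite /w (take_nth d) // -cats1 foldl_cat.
apply: runs_pair.
  by rewrite -e2; apply: runs_seq; [apply: runs_hd | apply: runs_tl].
apply: runs_seq; last exact: hp.
apply: (@runs_pair _ _ _ _ _ (enc _) (enc _)).
  by rewrite -e1; apply: runs_seq; apply: runs_hd.
by rewrite -e3; apply: runs_tl.
Qed.

Section Folds.
Context {X Y Z : Type} {eX : Enc X} {eY : Enc Y} {eZ : Enc Z}.

(** The context [x] travels with the value being folded. *)
Lemma comp_foldl (h : X -> Z -> Y -> Z) (z : X -> Z) (l : X -> seq Y) :
  comp (fun u : X * Z * Y => h u.1.1 u.1.2 u.2) -> comp z -> comp l ->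
  comp (fun x => foldl (h x) (z x) (l x)).
Proof.
move=> hh hz hl.
have {hh} hh : comp (fun u : Y * (X * Z) => (u.2.1, h u.2.1 u.2.2 u.1)).
  apply: comp_pair; first by comp_tac.
  by apply: (comp3 hh); comp_tac.
have hi : comp (fun x => (l x, (x, z x))) by comp_tac.
have [p [np hp]] := hh; have [q [nq hq]] := hi.
exists (q ;; fold_prog p ;; tl_prog); split; first by rewrite /= nq np.
move=> B Q x; apply: runs_seq; first exact: hq.
apply: (runs_seq (u := enc (foldl (fun (v : X * Z) a => (v.1, h v.1 v.2 a)) (x, z x) (l x)))).
  apply: runs_fold => i v _ d; exact: hp.
have -> : forall s z', foldl (fun (v : X * Z) a => (v.1, h v.1 v.2 a)) (x, z') s =
    (x, foldl (h x) z' s) by elim=> //= a s IH z'; rewrite IH.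
exact: (runs_tl B Q (enc (x, foldl (h x) (z x) (l x)))).
Qed.

End Folds.

Lemma comp_iter X Z {eX : Enc X} {eZ : Enc Z} (n : X -> nat) (h : X -> Z -> Z) (z : X -> Z) :
  comp (fun u : X * Z => h u.1 u.2) -> comp n -> comp z ->
  comp (fun x => iter (n x) (h x) (z x)).
Proof.
move=> hh hn hz.
have hl : comp (fun x => nseq (n x) false).
  by apply: comp_same hn => x; elim: (n x) => //= m IH; congr Node.
apply: (comp_ext (f := fun x => foldl (fun v _ => h x v) (z x) (nseq (n x) false))).
  move=> x; elim: (n x) (z x) => //= m IH v.
  by rewrite IH -iterSr.
apply: (comp_foldl (h := fun x v _ => h x v)) => //.
by apply: (comp2 hh); comp_tac.
Qed.


(** * Arithmetic, lists, bounded and unbounded search, finite tables *)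

Lemma comp_addn X {eX : Enc X} (m n : X -> nat) :
  comp m -> comp n -> comp (fun x => m x + n x).
Proof.
move=> hm hn; apply: (comp_ext (f := fun x => iter (n x) succn (m x))).
  by move=> x; rewrite addnC; elim: (n x) => //= k ->.
by apply: (comp_iter (h := fun _ => succn)); comp_tac.
Qed.

Lemma comp_subn X {eX : Enc X} (m n : X -> nat) :
  comp m -> comp n -> comp (fun x => m x - n x).
Proof.
move=> hm hn; apply: (comp_ext (f := fun x => iter (n x) predn (m x))).
  by move=> x; elim: (n x) => [|k /= ->]; rewrite ?subn0 // subnS.
by apply: (comp_iter (h := fun _ => predn)); comp_tac.
Qed.

Lemma comp_muln X {eX : Enc X} (m n : X -> nat) :
  comp m -> comp n -> comp (fun x => m x * n x).
Proof.
move=> hm hn; apply: (comp_ext (f := fun x => iter (n x) (fun k => m x + k) 0)).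
  by move=> x; elim: (n x) => [|k /= ->]; rewrite ?muln0 // mulnS.
by apply: (comp_iter (h := fun x k => m x + k)); comp_tac; apply: comp_addn; comp_tac.
Qed.

Lemma comp_leq X {eX : Enc X} (m n : X -> nat) :
  comp m -> comp n -> comp (fun x => m x <= n x).
Proof.
move=> hm hn; apply: (comp_ext (f := fun x => ~~ (0 < m x - n x))).
  by move=> x; rewrite subn_gt0 -leqNgt.
by apply/comp_negb/comp_nat_gt0/comp_subn.
Qed.

Lemma comp_eqn X {eX : Enc X} (m n : X -> nat) :
  comp m -> comp n -> comp (fun x => m x == n x).
Proof.
move=> hm hn; apply: (comp_ext (f := fun x => (m x <= n x) && (n x <= m x))).
  by move=> x; rewrite eqn_leq.
apply: (comp_andb (b := fun x => m x <= n x)); [exact: comp_leq hm hn | exact: comp_leq hn hm].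
Qed.

Lemma comp_eqb X {eX : Enc X} (b c : X -> bool) : comp b -> comp c -> comp (fun x => b x == c x).
Proof.
move=> hb hc; apply: comp_ext (comp_if hb hc (comp_negb hc)).
by move=> x; case: (b x); case: (c x).
Qed.

Ltac comp_arith := first
  [ comp_ctor
  | simple eapply comp_addn | simple eapply comp_subn | simple eapply comp_muln
  | simple eapply comp_leq | simple eapply comp_eqn | simple eapply comp_eqb ].

Ltac comp_prim ::= comp_arith.

Lemma comp_expn X {eX : Enc X} (m n : X -> nat) :
  comp m -> comp n -> comp (fun x => m x ^ n x).
Proof.
move=> hm hn; apply: (comp_ext (f := fun x => iter (n x) (fun k => m x * k) 1)).
  by move=> x; elim: (n x) => [|k /= ->]; rewrite ?expn0 // expnS.
by apply: (comp_iter (h := fun x k => m x * k)); comp_tac.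
Qed.
Section Lists.
Context {X Y Z : Type} {eX : Enc X} {eY : Enc Y} {eZ : Enc Z}.

Lemma comp_rev (l : X -> seq Y) : comp l -> comp (fun x => rev (l x)).
Proof.
move=> hl; apply: (comp_ext (f := fun x => foldl (fun z a => a :: z) [::] (l x))).
  move=> x; rewrite /rev; elim: (l x) [::] => //= a s IH z; exact: IH.
by apply: (comp_foldl (h := fun _ z a => a :: z)); comp_tac.
Qed.

Lemma comp_cat (l r : X -> seq Y) : comp l -> comp r -> comp (fun x => l x ++ r x).
Proof.
move=> hl hr.
apply: (comp_ext (f := fun x => foldl (fun z a => a :: z) (r x) (rev (l x)))).
  by move=> x; rewrite foldl_rev; elim: (l x) => //= a s ->.
by apply: (comp_foldl (h := fun _ z a => a :: z)) (comp_rev hl); comp_tac.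
Qed.

End Lists.
Section Lists2.
Context {X Y Z : Type} {eX : Enc X} {eY : Enc Y} {eZ : Enc Z}.

Lemma comp_map (h : X -> Y -> Z) (l : X -> seq Y) :
  comp (fun u : X * Y => h u.1 u.2) -> comp l ->
  comp (fun x => [seq h x a | a <- l x]).
Proof.
move=> hh hl.
apply: (comp_ext (f := fun x => rev (foldl (fun z a => h x a :: z) [::] (l x)))).
  move=> x; elim/last_ind: (l x) => //= s a IH.
  by rewrite -cats1 foldl_cat map_cat /= rev_cons IH cats1.
by apply: comp_rev; apply: (comp_foldl (h := fun x z a => h x a :: z)); comp_tac.
Qed.

Lemma comp_filter (h : X -> Y -> bool) (l : X -> seq Y) :
  comp (fun u : X * Y => h u.1 u.2) -> comp l ->
  comp (fun x => [seq a <- l x | h x a]).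
Proof.
move=> hh hl.
apply: (comp_ext (f := fun x =>
  rev (foldl (fun z a => if h x a then a :: z else z) [::] (l x)))).
  move=> x; elim/last_ind: (l x) => //= s a IH.
  rewrite -cats1 foldl_cat filter_cat /=.
  by case: ifP; rewrite ?rev_cons IH ?cats1 ?cats0.
apply: comp_rev.
by apply: (comp_foldl (h := fun x z a => if h x a then a :: z else z)); comp_tac.
Qed.

Lemma comp_all (h : X -> Y -> bool) (l : X -> seq Y) :
  comp (fun u : X * Y => h u.1 u.2) -> comp l -> comp (fun x => all (h x) (l x)).
Proof.
move=> hh hl.
apply: (comp_ext (f := fun x => foldl (fun b a => h x a && b) true (l x))).
  move=> x; elim/last_ind: (l x) => //= s a IH.
  by rewrite -cats1 foldl_cat all_cat /= andbT andbC IH.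
by apply: (comp_foldl (h := fun x b a => h x a && b)); comp_tac.
Qed.

Lemma comp_has (h : X -> Y -> bool) (l : X -> seq Y) :
  comp (fun u : X * Y => h u.1 u.2) -> comp l -> comp (fun x => has (h x) (l x)).
Proof.
move=> hh hl; apply: (comp_ext (f := fun x => ~~ all (fun a => ~~ h x a) (l x))).
  by move=> x; rewrite -has_predC; apply: eq_has => a /=; rewrite negbK.
by apply/comp_negb/(comp_all (h := fun x a => ~~ h x a)) => //; apply: comp_negb.
Qed.

Lemma comp_size (l : X -> seq Y) : comp l -> comp (fun x => size (l x)).
Proof.
move=> hl; apply: (comp_ext (f := fun x => foldl (fun k _ => k.+1) 0 (l x))).
  move=> x; elim/last_ind: (l x) => //= s a IH.
  by rewrite -cats1 foldl_cat /= IH size_cat addn1.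
by apply: (comp_foldl (h := fun _ k _ => k.+1)); comp_tac.
Qed.

Lemma comp_sumn (l : X -> seq nat) : comp l -> comp (fun x => sumn (l x)).
Proof.
move=> hl; apply: (comp_ext (f := fun x => foldl addn 0 (l x))).
  move=> x; elim/last_ind: (l x) => //= s a IH.
  by rewrite -cats1 foldl_cat sumn_cat IH /= addn0.
by apply: (comp_foldl (h := fun _ k m => k + m)); comp_tac.
Qed.

Lemma comp_iota (n : X -> nat) : comp n -> comp (fun x => iota 0 (n x)).
Proof.
move=> hn.
apply: (comp_ext (f := fun x =>
  rev (iter (n x) (fun p : nat * seq nat => (p.1.+1, p.1 :: p.2)) (0, [::])).2)).
  move=> x.
  suff -> k : iter k (fun p : nat * seq nat => (p.1.+1, p.1 :: p.2)) (0, [::]) =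
     (k, rev (iota 0 k)) by rewrite revK.
  elim: k => // k IH; rewrite iterS IH.
  have -> : iota 0 k.+1 = iota 0 k ++ [:: k] by rewrite -addn1 iotaD.
  by rewrite rev_cat.
apply/comp_rev/comp_snd.
apply: (comp_iter (h := fun _ (p : nat * seq nat) => (p.1.+1, p.1 :: p.2)));
  by comp_tac.
Qed.

End Lists2.
Ltac comp_lists := first
  [ comp_arith
  | simple eapply comp_expn | simple eapply comp_rev | simple eapply comp_cat
  | simple eapply comp_map | simple eapply comp_filter | simple eapply comp_all
  | simple eapply comp_has | simple eapply comp_size | simple eapply comp_sumn
  | simple eapply comp_iota ].

Ltac comp_prim ::= comp_lists.

(** The quotient is the number of positive multiples of [d] up to [m]. *)
Lemma comp_divn X {eX : Enc X} (m d : X -> nat) : (forall x, 0 < d x) ->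
  comp m -> comp d -> comp (fun x => m x %/ d x).
Proof.
move=> d0 hm hd.
apply: (comp_ext (f := fun x => size [seq k <- iota 0 (m x) | k.+1 * d x <= m x])).
  move=> x; rewrite size_filter.
  have -> : iota 0 (m x) = iota 0 (m x %/ d x) ++
      iota (m x %/ d x) (m x - m x %/ d x).
    by rewrite -{1}(subnKC (leq_div (m x) (d x))) iotaD add0n.
  rewrite count_cat.
  rewrite (@eq_in_count _ _ predT); last first.
    by move=> k; rewrite mem_iota /= add0n => h; rewrite -leq_divRL.
  rewrite count_predT size_iota (@eq_in_count _ _ pred0) ?count_pred0 ?addn0 //.
  move=> k; rewrite mem_iota /= => /andP[h _].
  by rewrite -leq_divRL // ltnNge h.
by apply: comp_size; apply: (comp_filter (h := fun x k => k.+1 * d x <= m x)); comp_tac.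
Qed.

(** One string is folded along the other, and loses its head at every step. *)
Lemma comp_eqstr X {eX : Enc X} (s t : X -> str) :
  comp s -> comp t -> comp (fun x => s x == t x).
Proof.
move=> hs ht.
pose g (p : bool * str) (b : bool) :=
  ([&& p.1, ~~ nilp p.2 & head false p.2 == b], behead p.2).
have hg : comp (fun u : X * (bool * str) * bool => g u.1.2 u.2).
  rewrite /g; comp_tac.
apply: (comp_ext (f := fun x => (foldl g (true, t x) (s x)).1 &&
   ~~ ~~ nilp (foldl g (true, t x) (s x)).2)); last first.
  have hf : comp (fun x => foldl g (true, t x) (s x)).
    by apply: (comp_foldl (h := fun _ => g)); comp_tac.
  by comp_tac.
move=> x; suff h b : (foldl g (b, t x) (s x)).1 &&
    ~~ ~~ nilp (foldl g (b, t x) (s x)).2 = b && (s x == t x) by exact: (h true).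
elim: (s x) (t x) b => [|a l IH] [|a' r] b; rewrite ?[foldl _ _ (_ :: _)]/= ?IH //=.
- by rewrite !andbF.
- by rewrite eqseq_cons andbA (eq_sym a).
Qed.
Lemma comp_memstr X {eX : Enc X} (s : X -> str) (l : X -> seq str) :
  comp s -> comp l -> comp (fun x => s x \in l x).
Proof.
move=> hs hl; apply: (comp_ext (f := fun x => has (fun a => a == s x) (l x))).
  by move=> x; rewrite -has_pred1.
apply: (comp_has (h := fun x a => a == s x)) => //.
by apply: comp_eqstr; comp_tac.
Qed.
Ltac comp_prim ::= first [comp_lists | simple eapply comp_eqstr | simple eapply comp_memstr].

Definition search_init := pair_prog (const_prog Leaf) Skip.
Definition search_test p := if_prog p (const_prog Leaf) (const_prog (Node Leaf Leaf)).
Definition search_next := pair_prog (pair_prog (const_prog Leaf) hd_prog) tl_prog.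
Definition search_prog p := search_init ;; loop_prog (search_test p) search_next.

Lemma runs_search_test B Q X {eX : Enc X} p (P : X -> nat -> bool) x k :
  (forall x k, runs B Q p (enc (k, x)) (enc (P x k))) ->
  runs B Q (search_test p) (enc (k, x)) (enc (~~ P x k)).
Proof.
move=> h; apply: runs_if; first exact: h.
by case: (P x k) => /=; apply: runs_const.
Qed.

Lemma runs_search_next B Q X {eX : Enc X} (x : X) k :
  runs B Q search_next (enc (k, x)) (enc (k.+1, x)).
Proof.
apply: (@runs_pair _ _ _ _ _ (enc k.+1) (enc x)).
  apply: (@runs_pair _ _ _ _ _ Leaf (enc k)); first exact: runs_const.
  exact: (runs_hd B Q (enc (k, x))).
exact: (runs_tl B Q (enc (k, x))).
Qed.

Lemma runs_search_init B Q X {eX : Enc X} (x : X) :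
  runs B Q search_init (enc x) (enc (0, x)).
Proof.
apply: (@runs_pair _ _ _ _ _ Leaf (enc x)); first exact: runs_const.
exact: runs_skip.
Qed.

Lemma ex_search B Q X {eX : Enc X} p (P : X -> nat -> bool) x n s io :
  (forall x k, runs B Q p (enc (k, x)) (enc (P x k))) ->
  P x n -> (forall k, k < n -> ~~ P x k) ->
  exec B Q (While TD (loop_body (search_test p) search_next))
    (st (code (enc (0, x)) ++ s) [::] [::] [:: true] [::] io)
    (st (code (enc (n, x)) ++ s) [::] [::] [::] [::] io).
Proof.
move=> hp Pn nP.
apply: (@ex_loop _ _ _ _ _ (fun i => enc (i, x)) (fun i => enc (~~ P x i))) => i.
  move=> le; split; first exact: runs_search_test.
  case: (ltnP i n) => h; first by rewrite nP.
  by have -> : i = n; [apply/eqP; rewrite eqn_leq le | rewrite Pn].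
by move=> _; exact: runs_search_next.
Qed.

Lemma runs_search B Q X {eX : Enc X} p (P : X -> nat -> bool) x n :
  (forall x k, runs B Q p (enc (k, x)) (enc (P x k))) ->
  P x n -> (forall k, k < n -> ~~ P x k) ->
  runs B Q (search_prog p) (enc x) (enc (n, x)).
Proof.
move=> hp Pn nP; apply: runs_seq; first exact: runs_search_init.
move=> s io; apply: ESeq; first by apply: ex_push; rewrite updE.
exact: ex_search hp Pn nP.
Qed.

(** A search is allowed to be unbounded as long as it always succeeds. *)
Lemma comp_search X {eX : Enc X} (P : X -> nat -> bool) (m : X -> nat) :
  comp (fun u : X * nat => P u.1 u.2) ->
  (forall x, P x (m x)) -> (forall x k, k < m x -> ~~ P x k) -> comp m.
Proof.
move=> hP h1 h2.
have [p [np hp]] : comp (fun u : nat * X => P u.2 u.1).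
  by apply: (comp2 hP); comp_tac.
exists (search_prog p ;; hd_prog); split; first by rewrite /= np.
move=> B Q x; apply: (runs_seq (u := enc (m x, x))).
  apply: (runs_search (P := P)) => [y k||k]; first exact: (hp B Q (k, y)).
    exact: h1.
  exact: h2.
exact: (runs_hd B Q (enc (m x, x))).
Qed.

#[export] Instance Enc_fin (T : finType) : Enc T | 100 := fun x => enc_nat (enum_rank x).

(** An element of a finite type is coded by its number, so that finitely many
    comparisons of numbers select the branch. *)
Lemma comp_fincase X Y (T : finType) {eX : Enc X} {eY : Enc Y}
    (F : T -> X -> Y) (g : X -> T) :
  (forall a, comp (F a)) -> comp g -> comp (fun x => F (g x) x).
Proof.
move=> hF hg.
have hr : comp (fun x => enum_rank (g x) : nat) by apply: comp_same hg.
case: (pickP (mem T)) => [a0 _|no]; last first.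
  by exists Skip; split=> // B Q x; have := no (g x).
pose G s x := foldr (fun a y => if (enum_rank (g x) : nat) == enum_rank a
   then F a x else y) (F a0 x) s.
have hG s : comp (G s).
  elim: s => [|a s IH] /=; first exact: hF.
  apply: (comp_if (b := fun x => (enum_rank (g x) : nat) == enum_rank a)) => //.
  by apply: comp_eqn => //; apply: comp_const.
apply: comp_ext (hG (enum T)) => x; rewrite /G.
have : g x \in enum T by rewrite mem_enum.
elim: (enum T) => //= a s IH; rewrite inE.
have -> : ((enum_rank (g x) : nat) == enum_rank a) = (g x == a).
  by rewrite -[LHS]/(enum_rank (g x) == enum_rank a) (inj_eq enum_rank_inj).
by case: eqP => [->|_ /IH].
Qed.

Lemma comp_fin X Y (T : finType) {eX : Enc X} {eY : Enc Y} (F : T -> Y) (g : X -> T) :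
  comp g -> comp (fun x => F (g x)).
Proof. by apply: (comp_fincase (F := fun a _ => F a)) => a; apply: comp_const. Qed.

(** * Simulating Turing machines *)

Section FiniteFunctions.
Context {X Y : Type} {eX : Enc X} {eY : Enc Y}.
Variable T : finType.

#[export] Instance Enc_ffun : Enc {ffun T -> Y} | 10 := fun f => enc [seq f t | t <- enum T].

Lemma comp_nth (d : Y) (l : X -> seq Y) i : comp l -> comp (fun x => nth d (l x) i).
Proof.
elim: i l => [|i IH] l hl.
  apply: (comp_ext (f := fun x => head d (l x))); first by move=> x; case: (l x).
  by apply: comp_head => //; apply: comp_const.
apply: (comp_ext (f := fun x => nth d (behead (l x)) i)).
  by move=> x; case: (l x) => //=; rewrite nth_nil.
by apply: IH; apply: comp_behead.
Qed.

Lemma comp_ffun_app (d : Y) t (f : X -> {ffun T -> Y}) :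
  comp f -> comp (fun x => f x t).
Proof.
move=> hf; apply: (comp_ext (f := fun x => nth d [seq f x t | t <- enum T] (index t (enum T)))).
  by move=> x; rewrite (nth_map t) ?nth_index ?index_mem ?mem_enum.
by apply: comp_nth; apply: comp_same hf.
Qed.

Lemma comp_ffun (g : T -> X -> Y) :
  (forall t, comp (g t)) -> comp (fun x => [ffun t => g t x]).
Proof.
move=> hg; apply: (comp_same (g := fun x => [seq g t x | t <- enum T])).
  by move=> x; congr enc; apply: eq_map => t; rewrite ffunE.
elim: (enum T) => [|t s IH] /=; first exact: comp_const.
exact: comp_cons.
Qed.

(** Finitely many observations with finitely many outcomes can be resolved by
    nested case distinctions. *)
Lemma comp_ffun_case (S : finType) (a0 : {ffun T -> S})
    (F : {ffun T -> S} -> X -> Y) (g : T -> X -> S) :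
  (forall a, comp (F a)) -> (forall t, comp (g t)) ->
  comp (fun x => F [ffun t => g t x] x).
Proof.
move=> hF hg.
have h s : uniq s -> forall a : {ffun T -> S},
    comp (fun x => F [ffun t => if t \in s then g t x else a t] x).
  elim: s => [_ a|t0 s IH /andP[t0s us] a].
    apply: (comp_ext (f := F a)) => // x.
    by congr (F _ x); apply/ffunP => t; rewrite ffunE.
  pose G b x := F [ffun t => if t \in s then g t x else if t == t0 then b else a t] x.
  apply: (comp_ext (f := fun x => G (g t0 x) x)).
    move=> x; congr (F _ x); apply/ffunP => t; rewrite !ffunE inE.
    by case: eqP => [->|_] /=; rewrite ?(negPf t0s).
  apply: (comp_fincase (F := G)) => // b.
  apply: (comp_ext (f := fun x => F [ffun t => if t \in s then g t x
     else [ffun t => if t == t0 then b else a t] t] x)); last exact: IH.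
  by move=> x; congr (F _ x); apply/ffunP => t; rewrite !ffunE.
apply: (comp_ext (f := fun x => F [ffun t => if t \in enum T then g t x else a0 t] x)).
  by move=> x; congr (F _ x); apply/ffunP => t; rewrite !ffunE mem_enum.
exact: (h _ (enum_uniq T) a0).
Qed.

End FiniteFunctions.

(* A symbol is an option as well; its code is to be its number in the alphabet. *)
#[export] Instance Enc_symbol (aux : finType) : Enc (symbol aux) | 0 :=
  @Enc_fin (symbol aux).
#[export] Instance Enc_tape aux : Enc (tape aux) := @Enc_prod _ _ _ _.
#[export] Instance Enc_config M : Enc (config M) := @Enc_prod _ _ _ _.

Definition olist (O : seq str) : set str := fun q => q \in O.

Lemma in_olist O q : (q \in olist O) = (q \in O).
Proof. by apply/idP/idP; rewrite inE. Qed.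

Definition bit_of (aux : finType) (a : symbol aux) : option bool :=
  if a is Some (inl b) then Some b else None.

Lemma comp_tape_left X {eX : Enc X} aux (t : X -> tape aux) :
  comp t -> comp (fun x => (t x).1).
Proof. by move=> ht; exact: (@comp_fst X _ _ eX _ _ t ht). Qed.

Lemma comp_tape_right X {eX : Enc X} aux (t : X -> tape aux) :
  comp t -> comp (fun x => (t x).2).
Proof. by move=> ht; exact: (@comp_snd X _ _ eX _ _ t ht). Qed.

Lemma comp_tape X {eX : Enc X} aux (l r : X -> seq (symbol aux)) :
  comp l -> comp r -> comp (fun x => (l x, r x) : tape aux).
Proof. by move=> hl hr; exact: (@comp_pair X _ _ eX _ _ l r hl hr). Qed.

Lemma comp_state X {eX : Enc X} M (c : X -> config M) :
  comp c -> comp (fun x => (c x).1).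
Proof. by move=> hc; exact: (@comp_fst X _ _ eX _ _ c hc). Qed.

Lemma comp_tapes X {eX : Enc X} M (c : X -> config M) :
  comp c -> comp (fun x => (c x).2).
Proof. by move=> hc; exact: (@comp_snd X _ _ eX _ _ c hc). Qed.

Lemma comp_config X {eX : Enc X} M (q : X -> tm_state M)
    (t : X -> {ffun tm_tapes M -> tape (tm_aux M)}) :
  comp q -> comp t -> comp (fun x => (q x, t x) : config M).
Proof. by move=> hq ht; exact: (@comp_pair X _ _ eX _ _ q t hq ht). Qed.

Lemma comp_tape_str X {eX : Enc X} aux (t : X -> tape aux) :
  comp t -> comp (fun x => tape_str (t x)).
Proof.
move=> ht.
pose g (p : bool * str) (a : symbol aux) : bool * str :=
  if p.1 && isSome (bit_of a) then (true, odflt false (bit_of a) :: p.2) else (false, p.2).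
apply: (comp_ext (f := fun x => rev (foldl g (true, [::]) (t x).2).2)).
  move=> x; rewrite /tape_str; case: (t x) => _ r /=.
  have -> v : rev (foldl g (true, v) r).2 = rev v ++ leading_bits r; last by [].
  elim: r v => [|a r IH] v /=; first by rewrite cats0.
  case: a => [[b|c]|] /=; last 2 first.
  - by elim: r {IH} => [|? ? IH] //=; rewrite cats0.
  - by elim: r {IH} => [|? ? IH] //=; rewrite cats0.
  by rewrite IH rev_cons cat_rcons.
apply: comp_rev; apply: comp_snd.
have hb : comp (fun u : X * (bool * str) * symbol aux => bit_of u.2).
  exact: (comp_fin (@bit_of aux) (comp_snd comp_id)).
apply: (comp_foldl (h := fun _ => g)); last exact: comp_tape_right.
  by rewrite /g; comp_tac.
exact: comp_const.
Qed.

Lemma comp_scanned X {eX : Enc X} aux (t : X -> tape aux) :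
  comp t -> comp (fun x => scanned (t x)).
Proof.
move=> ht; apply: comp_head; first exact: comp_const.
exact: comp_tape_right.
Qed.

Lemma comp_write_move X {eX : Enc X} aux (sd : symbol aux * dir) (t : X -> tape aux) :
  comp t -> comp (fun x => write_move sd (t x)).
Proof.
move=> ht; have h1 := comp_tape_left ht.
have h2 := comp_tape_right ht.
have h3 : comp (fun x => head None (t x).1) by comp_tac.
have h4 : comp (fun x => sd.1 :: behead (t x).2) by comp_tac.
case: sd h4 => a [] /= h4; rewrite /write_move /=.
- by apply: comp_tape; [exact: comp_behead | exact: comp_cons].
- by apply: comp_tape; [exact: comp_cons (comp_const a) h1 | exact: comp_behead].
- exact: comp_tape.
Qed.

Section Simulation.
Variable M : oracle_tm.

Definition tm_step (O : seq str) (c : config M) : config M := step (olist O) c.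

(** The transition function of [M] is a finite table, looked up by the state and
    by the vector of scanned symbols. *)
Lemma comp_step : comp (fun u : seq str * config M => tm_step u.1 u.2).
Proof.
pose A := {ffun tm_tapes M -> symbol (tm_aux M)}.
pose F (q : tm_state M) (u : seq str * config M) : config M :=
  match tm_prog q with
  | Halt => u.2
  | Query yes no => (if tape_str (u.2.2 (tm_query M)) \in u.1 then yes else no, u.2.2)
  | Move delta =>
      let a := delta [ffun t => scanned (u.2.2 t)] in
      (a.1, [ffun t => write_move (a.2 t) (u.2.2 t)])
  end.
have hc : comp (fun u : seq str * config M => u.2.2).
  by apply: comp_tapes; apply: comp_snd; apply: comp_id.
have hq : comp (fun u : seq str * config M => u.2.1).
  by apply: comp_state; apply: comp_snd; apply: comp_id.
apply: (comp_ext (f := fun u => F u.2.1 u)).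
  move=> [os [q t]]; rewrite /F /tm_step /step /=.
  by case: (tm_prog q) => //= yes no; rewrite in_olist.
apply: (comp_fincase (F := F)) => // q; rewrite /F.
case: (tm_prog q) => [|yes no|delta].
- exact: comp_snd comp_id.
- apply: comp_config => //.
  apply: comp_if; try exact: comp_const.
  apply: comp_memstr; last exact: comp_fst comp_id.
  by apply: comp_tape_str; apply: (comp_ffun_app ([::], [::])).
- pose D (a : A) (u : seq str * config M) : config M :=
    ((delta a).1, [ffun t => write_move ((delta a).2 t) (u.2.2 t)]).
  apply: (comp_ext (f := fun u : seq str * config M => D [ffun t => scanned (u.2.2 t)] u)); first by move=> u.
  apply: (comp_ffun_case [ffun=> None] (F := D)
    (g := fun t (u : seq str * config M) => scanned (u.2.2 t))).
    move=> a; apply: comp_config; first exact: comp_const.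
    apply: comp_ffun => t; apply: comp_write_move.
    exact: (comp_ffun_app ([::], [::])).
  move=> t; apply: (comp_same (g := fun u : seq str * config M => scanned (u.2.2 t))) => //.
  by apply: comp_scanned; apply: (comp_ffun_app ([::], [::])).
Qed.

Definition out (O : seq str) (x : str) (t : nat) : option str :=
  let c := run M (olist O) x t in
  if is_halt (tm_prog c.1) then Some (tape_str (c.2 (tm_io M))) else None.

Lemma comp_out X {eX : Enc X} (O : X -> seq str) (x : X -> str) (t : X -> nat) :
  comp O -> comp x -> comp t -> comp (fun u => out (O u) (x u) (t u)).
Proof.
move=> hO hx ht.
have hi : comp (fun u => init M (x u)).
  apply: comp_config; first exact: comp_const.
  apply: comp_ffun => k; case: (k == tm_io M); last exact: comp_const.
  apply: comp_tape; first exact: comp_const.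
  apply: (comp_map (h := fun _ b => Some (inl b))) => //.
  apply: (comp_ext (f := fun u : X * bool => if u.2 then Some (inl true) else Some (inl false))).
    by move=> [u []].
  by comp_tac.
have hs := comp_step.
have hr : comp (fun u => run M (olist (O u)) (x u) (t u)).
  apply: (comp_iter (h := fun u => tm_step (O u))) => //.
  by apply: (comp2 hs); comp_tac.
apply: comp_if; last exact: comp_const.
  exact: (comp_fin (fun q => is_halt (tm_prog q)) (comp_state hr)).
by apply/comp_Some/comp_tape_str/(comp_ffun_app ([::], [::])); apply: comp_tapes.
Qed.

Lemma outP O x y : halts_with M (olist O) x y <-> exists t, out O x t = Some y.
Proof.
split=> [[t [h <-]]|[t]]; first by exists t; rewrite /out h.
by rewrite /out; case: ifP => // h [<-]; exists t.
Qed.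

Lemma out_mono O x y t t' : t <= t' -> out O x t = Some y -> out O x t' = Some y.
Proof.
move=> /subnK <-; rewrite /out; case: ifP => // h [<-].
by rewrite /run iterD step_halted // h.
Qed.

(** Oracles need to agree only on what is actually asked. *)
Lemma run_agree B B' x n :
  (forall q, queries M B x q -> (q \in B) = (q \in B')) ->
  run M B x n = run M B' x n.
Proof.
move=> h; elim: n => //= n IH; rewrite -/(run M B x n) -/(run M B' x n) -IH.
rewrite /step; case e : (tm_prog _) => [|yes no|delta] //.
by rewrite h //; exists n; cbv zeta; rewrite e.
Qed.

Lemma run_query_free B B' x n : query_free M -> run M B x n = run M B' x n.
Proof.
move=> h; apply: run_agree => q [k []].
by rewrite (negPf (h _)).
Qed.

End Simulation.

(** * Input, output and oracle questions *)

Section InputOutput.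
Variables (B : set str) (Q : str -> Prop).
Local Notation ex := (exec B Q).
Local Notation S a io := (st a [::] [::] [::] [::] io).

Definition load_prog :=
  Push TA false ;;
  While TIO (Pop TIO Skip
    (Push TA false ;; Push TA true)
    (Push TA false ;; Push TA false ;; Push TA true ;; Push TA true)).

Lemma ex_load x : ex load_prog (S [::] x) (S (code (enc (rev x))) [::]).
Proof.
apply: ESeq; first by apply: ex_push; rewrite updE.
have h y : ex (While TIO (Pop TIO Skip (Push TA false ;; Push TA true)
    (Push TA false ;; Push TA false ;; Push TA true ;; Push TA true)))
    (S (code (enc (y : str))) x) (S (code (enc (catrev x y))) [::]).
  elim: x y => [|b x IH] y; first exact: EWhileE.
  apply: EWhile => //; last exact: (IH (b :: y)).
  apply: EPop => //; rewrite updE; case: b.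
    do 3![apply: ESeq; first by apply: ex_push; rewrite updE].
    by apply: ex_push; rewrite updE.
  apply: ESeq; first by apply: ex_push; rewrite updE.
  by apply: ex_push; rewrite updE.
exact: (h [::]).
Qed.

Definition unload_body t :=
  Pop TD Skip Skip
    (Pop TA Skip Skip
      (Pop TA Skip
        (Push t false ;; Push TD true)
        (Pop TA Skip Skip Skip ;; Pop TA Skip Skip Skip ;;
         Push t true ;; Push TD true))).
Definition unload_prog t := Push TD true ;; While TD (unload_body t).

(* The same loop serves the output tape and the query tape. *)
Lemma ex_unload (tq : bool) y w a v :
  ex (unload_prog (if tq then TQ else TIO))
     (st (code (enc (y : str)) ++ a) [::] [::] [::]
         (if tq then w else v) (if tq then v else w))
     (st a [::] [::] [::]
         (if tq then catrev y w else v) (if tq then v else catrev y w)).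
Proof.
apply: ESeq; first by apply: ex_push; rewrite updE.
have hpush b' u w' : ex (Push (if tq then TQ else TIO) b')
    (st u [::] [::] [::] (if tq then w' else v) (if tq then v else w'))
    (st u [::] [::] [::] (if tq then b' :: w' else v) (if tq then v else b' :: w')).
  by apply: ex_push; case: (tq); rewrite updE.
elim: y w => [|b y IH] w.
  apply: EWhile => //; last exact: EWhileE.
  apply: (@EPop _ _ TD _ _ _ true [::]) => //=; rewrite updE.
  by apply: EPop => //=; rewrite updE; apply: ESkip.
apply: EWhile => //; last exact: (IH (b :: w)).
apply: (@EPop _ _ TD _ _ _ true [::]) => //=; rewrite updE.
apply: EPop => //=; rewrite updE; case: b => /=.
- apply: EPop => //=; rewrite updE.
  apply: ESeq; first by apply: EPop => //=; rewrite updE; apply: ESkip.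
  apply: ESeq; first by apply: EPop => //=; rewrite updE; apply: ESkip.
  by apply: ESeq; [exact: hpush | apply: ex_push; case: (tq); rewrite updE].
- apply: EPop => //=; rewrite updE.
  by apply: ESeq; [exact: hpush | apply: ex_push; case: (tq); rewrite updE].
Qed.

Definition clear_query := While TQ (Pop TQ Skip Skip Skip).
Definition ask_prog :=
  unload_prog TQ ;;
  Ask (clear_query ;; push_all (code (enc false)))
      (clear_query ;; push_all (code (enc true))).

(** Unloading a list onto the query tape reverses it. *)
Lemma runs_ask (q : str) : Q (rev q) ->
  runs B Q ask_prog (enc q) (enc (rev q \in B)).
Proof.
move=> hQ s io; apply: ESeq; first exact: (ex_unload true q [::] s io).
apply: EAsk => //=.
have hc w : ex clear_query (st s [::] [::] [::] w io) (S s io).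
  elim: w => [|b w IH]; first exact: EWhileE.
  apply: EWhile => //; last exact: IH.
  by apply: EPop => //; rewrite updE; case: b; apply: ESkip.
rewrite -/(rev q); case: (rev q \in B); apply: ESeq; first exact: hc.
- exact: (ex_push_all B Q (code (enc true))).
- exact: hc.
- exact: (ex_push_all B Q (code (enc false))).
Qed.

End InputOutput.

Lemma runs_top B Q p u v io : runs B Q p u v ->
  exec B Q p (st (code u) [::] [::] [::] [::] io) (st (code v) [::] [::] [::] [::] io).
Proof. by move=> /(_ [::] io); rewrite !cats0. Qed.

(** * Recursive functions and reductions from computable data *)

(** The program searches for the first [t] with [P x t] and then computes
    [u x t]; without such a [t] the search never ends, as it should. *)
Lemma search_machine (P : str -> nat -> bool) (u : str -> nat -> str)
    (F : str -> option str) :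
  comp (fun v : str * nat => P v.1 v.2) ->
  comp (fun v : str * nat => u v.1 v.2) ->
  (forall x y, F x = Some y <->
     exists t, [/\ P x t, forall k, k < t -> ~~ P x k & u x t = y]) ->
  partial_recursive F.
Proof.
move=> hP hu hF.
have [rp [nrp hrp]] : comp (fun x : str => rev x) by comp_tac.
have [p [np hp]] : comp (fun v : nat * str => P v.2 v.1).
  by apply: (comp2 hP); comp_tac.
have [wr [nwr hwr]] : comp (fun v : nat * str => rev (u v.2 v.1)) by comp_tac.
pose pc := search_test p.
pose pb := search_next.
pose c1 := (load_prog ;; rp ;; search_init ;; Push TD true).
pose c := (c1 ;; While TD (loop_body pc pb) ;; (wr ;; unload_prog TIO)).
have hc1 x : exec set0 (fun _ => True) c1 (st [::] [::] [::] [::] [::] x)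
    (st (code (enc (0, x))) [::] [::] [:: true] [::] [::]).
  apply: ESeq; first exact: ex_load.
  apply: ESeq; first exact: runs_top (hrp _ _ _).
  rewrite revK; apply: ESeq; first exact: runs_top (runs_search_init _ _ _).
  by apply: ex_push; rewrite updE.
have nc : noask c by rewrite /= nrp np nwr.
exists (program c); first exact: program_query_free.
have htest x k := @runs_search_test set0 (fun _ => True) _ _ p P x k
  (fun x k => hp set0 (fun _ => True) (k, x)).
have hnext (x : str) (k : nat) :
  runs set0 (fun _ => True) search_next (enc (k, x)) (enc (k.+1, x)).
  exact: runs_search_next.
move=> x; have [ext|noext] := pselect (exists t, P x t); last first.
  move=> y; split; first by move=> /hF[t [Pt _ _]]; case: noext; exists t.
  pose (I := fun s : store => exists k : nat,
    s = st (code (enc (k, x))) [::] [::] [:: true] [::] [::]).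
  move=> /(@program_div _ _ _ _ _ _ _ I _ (hc1 x)) [].
    by exists 0.
  move=> s [k ->]; split=> //.
  exists (st (code (enc (k.+1, x))) [::] [::] [:: true] [::] [::]); last by exists k.+1.
  have := ex_loop_go [::] [::] (htest x k) _ (hnext x k).
  rewrite !cats0; apply.
  by case e : (P x k) => //; case: noext; exists k.
have [t Pt tmin] := ex_minnP ext.
have nP k : k < t -> ~~ P x k.
  by rewrite ltnNge; apply: contra => /tmin.
have hh : halts_with (program c) set0 x (u x t).
  suff e : exec set0 (fun _ => True) c (st [::] [::] [::] [::] [::] x)
     (st [::] [::] [::] [::] [::] (u x t)) by exact: (program_exec e).1.
  apply: ESeq; first exact: hc1.
  apply: ESeq.
    have := @ex_search set0 (fun _ => True) _ _ p P x t [::] [::]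
      (fun x k => hp set0 (fun _ => True) (k, x)) Pt nP.
    by rewrite !cats0; apply.
  apply: ESeq.
    exact: runs_top (hwr _ _ (t, x)).
  have := ex_unload set0 (fun _ => True) false (rev (u x t)) [::] [::] [::].
  by rewrite cats0 -/(rev _) revK; apply.
move=> y; split=> [|hy].
  move=> /hF[t' [Pt' nP' <-]]; suff -> : t' = t by [].
  apply/eqP; rewrite eqn_leq tmin // andbT leqNgt.
  by apply/negP => /nP'; rewrite Pt.
by apply/hF; exists t; split=> //; apply: halts_with_inj hh hy.
Qed.

Lemma partial_recursive_out F : partial_recursive F ->
  exists M, forall x y, F x = Some y <-> exists t, out M [::] x t = Some y.
Proof.
move=> [M qf h]; exists M => x y; rewrite h -outP /halts_with.
have e n : run M set0 x n = run M (olist [::]) x n by exact: run_query_free.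
by split=> -[n hn]; exists n; move: hn; rewrite e.
Qed.

Lemma comp_nseq X {eX : Enc X} (n : X -> nat) :
  comp n -> comp (fun x => nseq (n x) true).
Proof.
move=> hn; apply: (comp_ext (f := fun x => iter (n x) (cons true) [::])).
  by move=> x; elim: (n x) => //= k ->.
by apply: (comp_iter (h := fun _ => cons true)); comp_tac.
Qed.

(** The machine for [f] is simulated for longer and longer until it has halted. *)
Lemma total_recursive_comp f : total_recursive f -> comp f.
Proof.
move=> [M qf h].
have ex n : exists t, isSome (out M [::] (nseq n true) t).
  have [t ht] := h n; exists t; move: ht.
  rewrite (run_query_free _ (olist [::]) _ _ qf) => -[h1 _].
  by rewrite /out h1.
have hm : comp (fun n => ex_minn (ex n)).
  apply: (comp_search (P := fun n t => isSome (out M [::] (nseq n true) t))).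
  - by apply/comp_isSome/comp_out; [|apply: comp_nseq|]; comp_tac.
  - by move=> n; case: ex_minnP.
  - by move=> n k; case: ex_minnP => m _ mmin; rewrite ltnNge; apply: contra => /mmin.
apply: (comp_ext (f := fun n => size (odflt [::] (out M [::] (nseq n true) (ex_minn (ex n)))))).
  move=> n; case: ex_minnP => m; case e : (out _ _ _ _) => [y|] // _ _ /=.
  have hy : halts_with M (olist [::]) (nseq n true) y by apply/outP; exists m.
  have hy' : halts_with M (olist [::]) (nseq n true) (nseq (f n) true).
    have [t ht] := h n; exists t.
    by rewrite -(run_query_free set0 _ _ _ qf).
  by rewrite (halts_with_inj hy hy') size_nseq.
by apply/comp_size/comp_odflt; [|apply: comp_out]; comp_tac; apply: comp_nseq; comp_tac.
Qed.

(** A left fold, because an oracle program goes through its questions one by one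
    and puts aside those that are answered positively. *)
Definition answered (B : set str) (l : seq str) : seq str :=
  foldl (fun z q => if q \in B then q :: z else z) [::] l.

Lemma mem_answered B l q : (q \in answered B l) = (q \in l) && (q \in B).
Proof.
suff h z : (q \in foldl (fun z q => if q \in B then q :: z else z) z l) =
    (q \in l) && (q \in B) || (q \in z) by rewrite /answered h in_nil orbF.
elim: l z => [|a l IH] z //=; rewrite IH inE.
case: ifP => aB; rewrite ?inE; case: eqP => [->|] //=; rewrite aB ?orbT //.
by rewrite andbF.
Qed.

(** All questions are fixed by the input and asked first; what follows is a
    computation from the answers alone. *)
Lemma oracle_machine (B A : set str) (qs : str -> seq str)
    (P post : str * seq str -> nat -> bool) :
  comp qs -> comp (fun v : str * seq str * nat => P v.1 v.2) ->
  comp (fun v : str * seq str * nat => post v.1 v.2) ->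
  (forall x, exists n, P (x, answered B (qs x)) n) ->
  (forall x n, P (x, answered B (qs x)) n ->
     post (x, answered B (qs x)) n = (x \in A)) ->
  exists2 M, turing_reducible_via M A B &
    forall x q, queries M B x q -> q \in qs x.
Proof.
move=> hqs hP hpost ex hA.
have [p1 [np1 hp1]] : comp (fun x : str =>
    ([seq rev q | q <- qs (rev x)], (rev x, Nil str))).
  apply: comp_pair; last by comp_tac.
  by apply: (comp_map (h := fun _ q => rev q)); comp_tac.
pose g (u : bool * (str * (str * seq str))) : str * seq str :=
  (u.2.2.1, if u.1 then rev u.2.1 :: u.2.2.2 else u.2.2.2).
have [pg [npg hpg]] : comp g by rewrite /g; comp_tac.
pose pask := (pair_prog (hd_prog ;; ask_prog) Skip ;; pg).
have [p [np hp]] : comp (fun v : nat * (str * seq str) => P v.2 v.1).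
  by apply: (comp2 hP); comp_tac.
have [p2 [np2 hp2]] : comp (fun v : nat * (str * seq str) => [:: post v.2 v.1]).
  by apply: comp_cons; [apply: (comp2 hpost)|]; comp_tac.
pose c := (load_prog ;; p1 ;; fold_prog pask ;; search_prog p ;; p2 ;; unload_prog TIO).
suff hc x : exec B (fun q => q \in qs x) c (st [::] [::] [::] [::] [::] x)
    (st [::] [::] [::] [::] [::] [:: x \in A]).
  exists (program c) => x; first exact: (program_exec (hc x)).1.
  exact: (program_exec (hc x)).2.
pose Q (q : str) := q \in qs x; rewrite -/Q.
apply: ESeq; first exact: ex_load.
apply: ESeq; first exact: runs_top (hp1 _ _ _).
rewrite revK.
apply: ESeq.
  apply: runs_top.
  apply: (runs_fold (h := fun z q => (z.1, if rev q \in B then rev q :: z.2 else z.2))).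
  move=> i z; rewrite size_map => il d.
  set q := nth _ _ _.
  have hq : Q (rev q).
    by rewrite /Q /q (nth_map d) // revK mem_nth.
  apply: (runs_seq (u := enc (rev q \in B, (q, z)))); last exact: hpg.
  apply: (@runs_pair _ _ _ _ _ (enc (rev q \in B)) (enc (q, z))); last exact: runs_skip.
  by apply: (runs_seq (u := enc q)); [exact: (runs_hd B Q (enc (q, z))) | exact: runs_ask].
have -> : foldl (fun (z : str * seq str) q => (z.1, if rev q \in B then rev q :: z.2 else z.2))
    (x, [::]) [seq rev q | q <- qs x] = (x, answered B (qs x)).
  rewrite /answered; elim: (qs x) [::] => //= q l IH z; rewrite revK; exact: IH.
have [n Pn nmin] := ex_minnP (ex x).
apply: ESeq.
  apply: runs_top; apply: (runs_search (n := n) _ Pn).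
    by move=> y k; exact: (hp B Q (k, y)).
  by move=> k; rewrite ltnNge; apply: contra => /nmin.
apply: ESeq; first exact: runs_top (hp2 _ _ _).
rewrite /= hA //.
have := ex_unload B Q false [:: x \in A] [::] [::] [::].
by rewrite cats0; apply.
Qed.

(** * Strings, binary numerals and approximations of domains *)

Definition binval (q : str) : nat := foldl (fun v (b : bool) => v.*2 + b) 0 q.

(** The last [n] binary digits of [k], most significant first. *)
Fixpoint bits (n k : nat) : str :=
  if n is m.+1 then rcons (bits m k./2) (odd k) else [::].

Lemma binval_rcons q b : binval (rcons q b) = (binval q).*2 + b.
Proof. by rewrite /binval -cats1 foldl_cat. Qed.

Lemma size_bits n k : size (bits n k) = n.
Proof. by elim: n k => //= n IH k; rewrite size_rcons IH. Qed.

Lemma bitsK n k : k < 2 ^ n -> binval (bits n k) = k.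
Proof.
elim: n k => [|n IH] k /=; first by rewrite expn0 ltnS leqn0 => /eqP ->.
rewrite expnS mul2n => h; rewrite binval_rcons IH; last by rewrite ltn_half_double.
by rewrite addnC odd_double_half.
Qed.

Lemma binvalK q : bits (size q) (binval q) = q.
Proof.
elim/last_ind: q => // q b IH.
rewrite size_rcons /= binval_rcons addnC half_bit_double IH oddD odd_double addbF.
by case: b.
Qed.

Lemma binval_lt q : binval q < 2 ^ size q.
Proof.
elim/last_ind: q => // q b IH; rewrite size_rcons binval_rcons expnS mul2n.
rewrite -ltn_half_double addnC half_bit_double //.
Qed.

(** The extensions of [p] of a given length form an interval. *)
Lemma binval_prefix p q : prefix p q ->
  binval p * 2 ^ (size q - size p) <= binval q < (binval p).+1 * 2 ^ (size q - size p).
Proof.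
move=> /prefixP[r ->]; rewrite size_cat addKn.
elim/last_ind: r => [|r b /andP[IH1 IH2]].
  by rewrite cats0 expn0 !muln1 leqnn ltnSn.
rewrite -rcons_cat binval_rcons size_rcons expnS mul2n -!doubleMr; apply/andP; split.
  by apply: leq_trans (leq_addr _ _); rewrite leq_double.
apply: (@leq_trans (binval (p ++ r)).+1.*2); last by rewrite leq_double.
by rewrite doubleS ltnS; case: b; rewrite ?addn1 ?addn0.
Qed.

Definition strs n := [seq bits n k | k <- iota 0 (2 ^ n)].

Lemma mem_strs n x : (x \in strs n) = (size x == n).
Proof.
apply/mapP/eqP => [[k _ ->]|<-]; first by rewrite size_bits.
by exists (binval x); rewrite ?binvalK // mem_iota add0n binval_lt.
Qed.

Lemma uniq_strs n : uniq (strs n).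
Proof.
rewrite map_inj_in_uniq ?iota_uniq // => i j; rewrite !mem_iota !add0n => hi hj e.
by rewrite -(bitsK hi) e bitsK.
Qed.

Definition strsle n := foldl (fun l m => l ++ strs m) [::] (iota 0 n.+1).

Lemma strsleS n : strsle n.+1 = strsle n ++ strs n.+1.
Proof. by rewrite /strsle -[n.+2]addn1 iotaD foldl_cat. Qed.

Lemma mem_strsle n x : (x \in strsle n) = (size x <= n).
Proof.
elim: n => [|n IH]; first by rewrite mem_cat mem_strs leqn0.
by rewrite strsleS mem_cat IH mem_strs [RHS]leq_eqVlt orbC.
Qed.

Lemma uniq_strsle n : uniq (strsle n).
Proof.
elim: n => // n IH; rewrite strsleS cat_uniq IH uniq_strs andbT /=.
by apply/hasPn => x; rewrite mem_strs mem_strsle => /eqP ->; rewrite ltnn.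
Qed.

Lemma comp_half X {eX : Enc X} (n : X -> nat) : comp n -> comp (fun x => (n x)./2).
Proof.
move=> hn; apply: (comp_ext (f := fun x => n x %/ 2)).
  by move=> x; rewrite divn2.
by apply: comp_divn => //; comp_tac.
Qed.

Lemma comp_odd X {eX : Enc X} (n : X -> nat) : comp n -> comp (fun x => odd (n x)).
Proof.
move=> hn; apply: (comp_ext (f := fun x => iter (n x) negb false)).
  by move=> x; elim: (n x) => //= k ->.
by apply: (comp_iter (h := fun _ => negb)); comp_tac.
Qed.

Lemma comp_binval X {eX : Enc X} (q : X -> str) : comp q -> comp (fun x => binval (q x)).
Proof.
move=> hq; apply: (comp_foldl (h := fun _ v (b : bool) => v.*2 + b)) => //; last first.
  by comp_tac.
apply: (comp_ext (f := fun u : X * nat * bool => u.1.2 + u.1.2 + u.2)); last by comp_tac.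
by move=> u; rewrite addnn.
Qed.

Lemma comp_bits X {eX : Enc X} (n k : X -> nat) :
  comp n -> comp k -> comp (fun x => bits (n x) (k x)).
Proof.
move=> hn hk.
pose g (p : nat * str) : nat * str := (p.1./2, odd p.1 :: p.2).
have hg : comp g by apply: comp_pair; [apply: comp_half | apply: comp_cons; [apply: comp_odd|]]; comp_tac.
apply: (comp_ext (f := fun x => (iter (n x) g (k x, [::])).2)).
  move=> x; have h s : (iter (n x) g (k x, s)).2 = bits (n x) (k x) ++ s.
    elim: (n x) (k x) s => // m IH j s.
    by rewrite iterSr IH /= cat_rcons.
  by rewrite h cats0.
by apply: comp_snd; apply: (comp_iter (h := fun _ => g)); comp_tac.
Qed.

Lemma comp_strs X {eX : Enc X} (n : X -> nat) : comp n -> comp (fun x => strs (n x)).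
Proof.
move=> hn; apply: (comp_map (h := fun x k => bits (n x) k)); last by comp_tac.
by apply: comp_bits; comp_tac.
Qed.

Lemma comp_strsle X {eX : Enc X} (n : X -> nat) :
  comp n -> comp (fun x => strsle (n x)).
Proof.
move=> hn; apply: (comp_foldl (h := fun _ l m => l ++ strs m)); comp_tac.
by apply: comp_strs; comp_tac.
Qed.

(** Programs will carry a unary header that ends at the first [false]. *)
Lemma comp_index X {eX : Enc X} (q : X -> str) :
  comp q -> comp (fun x => index false (q x)).
Proof.
move=> hq.
apply: (comp_ext (f := fun x => foldl (fun n (b : bool) => if b then n.+1 else 0) 0 (rev (q x)))).
  move=> x; rewrite foldl_rev; elim: (q x) => // b s IH.
  by case: b; rewrite //= -IH.
by apply: (comp_foldl (h := fun _ n (b : bool) => if b then n.+1 else 0)); comp_tac.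
Qed.

Lemma comp_drop X {eX : Enc X} (n : X -> nat) (q : X -> str) :
  comp n -> comp q -> comp (fun x => drop (n x) (q x)).
Proof.
move=> hn hq; apply: (comp_ext (f := fun x => iter (n x) behead (q x))).
  move=> x; elim: (n x) (q x) => [|k IH] s; first by rewrite drop0.
  by rewrite iterSr IH; case: s.
by apply: (comp_iter (h := fun _ => behead)); comp_tac.
Qed.

Lemma comp_mem_false X {eX : Enc X} (q : X -> str) :
  comp q -> comp (fun x => false \in q x).
Proof.
move=> hq; apply: (comp_ext (f := fun x => has (fun b => ~~ b) (q x))).
  by move=> x; rewrite -has_pred1; apply: eq_has => -[].
by apply: (comp_has (h := fun _ b => ~~ b)); comp_tac.
Qed.

Lemma comp_double X {eX : Enc X} (n : X -> nat) : comp n -> comp (fun x => (n x).*2).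
Proof.
move=> hn; apply: (comp_ext (f := fun x => n x + n x)); last by comp_tac.
by move=> x; rewrite addnn.
Qed.

Ltac comp_strings := first
  [ comp_lists | simple eapply comp_double | simple eapply comp_mem_false
  | simple eapply comp_eqstr | simple eapply comp_memstr
  | simple eapply comp_binval | simple eapply comp_bits | simple eapply comp_strs
  | simple eapply comp_strsle | simple eapply comp_index | simple eapply comp_drop
  | simple eapply comp_out | simple eapply comp_nseq ].

Ltac comp_prim ::= comp_strings.

Section Approximation.
Variable M : oracle_tm.

Definition dl (t : nat) : seq str := [seq p <- strsle t | isSome (out M [::] p t)].

Lemma uniq_dl t : uniq (dl t).
Proof. exact: filter_uniq (uniq_strsle t). Qed.

Lemma mem_dl t p : (p \in dl t) = (size p <= t) && isSome (out M [::] p t).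
Proof. by rewrite mem_filter mem_strsle andbC. Qed.

Lemma dl_mono t t' : t <= t' -> {subset dl t <= dl t'}.
Proof.
move=> le p; rewrite !mem_dl => /andP[h1].
case e : (out _ _ _ _) => [y|] // _.
by rewrite (leq_trans h1 le) (out_mono le e).
Qed.

(** Divided by [2 ^ t], the measure of the part of the domain found by stage [t]. *)
Definition weight (t : nat) : nat := sumn [seq 2 ^ (t - size p) | p <- dl t].

(** The first [n] binary digits, as a number, of that measure. *)
Definition flo (n t : nat) : nat := (2 ^ n * weight t) %/ 2 ^ t.

Lemma flo_div n m t : n <= m -> flo n t = flo m t %/ 2 ^ (m - n).
Proof.
move=> le; rewrite /flo -divnMA mulnC.
have -> : 2 ^ m = 2 ^ (m - n) * 2 ^ n by rewrite -expnD subnK.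
by rewrite -mulnA [2 ^ t * _]mulnC divnMl ?expn_gt0 // mulnC.
Qed.

Definition output_bound (t : nat) : nat :=
  sumn [seq size (odflt [::] (out M [::] p t)) | p <- dl t].

Lemma output_boundP t p y : p \in dl t -> out M [::] p t = Some y ->
  size y <= output_bound t.
Proof.
move=> + e; rewrite /output_bound; elim: (dl t) => //= a l IH.
rewrite inE => /orP[/eqP <-|/IH h]; first by rewrite e leq_addr.
exact: leq_trans h (leq_addl _ _).
Qed.

Lemma comp_dl X {eX : Enc X} (t : X -> nat) : comp t -> comp (fun x => dl (t x)).
Proof.
by move=> ht; apply: (comp_filter (h := fun x p => isSome (out M [::] p (t x)))); comp_tac.
Qed.

Lemma comp_flo X {eX : Enc X} (n t : X -> nat) :
  comp n -> comp t -> comp (fun x => flo (n x) (t x)).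
Proof.
move=> hn ht; have hd := comp_dl ht.
have hw : comp (fun x => weight (t x)).
  by apply: comp_sumn; apply: (comp_map (h := fun x (p : str) => 2 ^ (t x - size p))); comp_tac.
by apply: comp_divn; [move=> x; rewrite expn_gt0 | comp_tac | comp_tac].
Qed.

Lemma comp_output_bound X {eX : Enc X} (t : X -> nat) :
  comp t -> comp (fun x => output_bound (t x)).
Proof.
move=> ht; have hd := comp_dl ht; apply: comp_sumn.
by apply: (comp_map (h := fun x p => size (odflt [::] (out M [::] p (t x))))); comp_tac.
Qed.

End Approximation.

Ltac comp_prim ::= first
  [ comp_strings
  | simple eapply comp_dl | simple eapply comp_flo | simple eapply comp_output_bound ].

(** Prefix-free sets of strings satisfy Kraft's inequality: split such a set
    by the first bit. *)
Lemma kraft_nat t (l : seq str) :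
  uniq l -> (forall p q, p \in l -> q \in l -> prefix p q -> p = q) ->
  all (fun p => size p <= t) l -> \sum_(p <- l) 2 ^ (t - size p) <= 2 ^ t.
Proof.
have one (s : seq str) m : uniq s -> (forall p, p \in s -> p = [::]) ->
    \sum_(p <- s) 2 ^ (m - size p) <= 2 ^ m.
  case: s => [|a [|b s]] us h; first by rewrite big_nil.
    by rewrite big_seq1 (h a) ?inE // subn0.
  have ea : a = [::] by apply: h; rewrite inE eqxx.
  have eb : b = [::] by apply: h; rewrite !inE eqxx orbT.
  by move: us; rewrite ea eb.
elim: t l => [|t IH] l ul pf /allP hl.
  by apply: one => // p /hl; case: p.
have [nl|nnl] := boolP ([::] \in l).
  by apply: one => // p pl; rewrite (pf [::] p) // prefix0s.
pose lb b := [seq behead p | p <- l & head (~~ b) p == b].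
have hlb b p : p \in lb b -> b :: p \in l.
  case/mapP => q; rewrite mem_filter => /andP[/eqP hq ql] ->.
  by case: q hq ql => [|c q] /= hq ql; [case: b hq | rewrite -hq].
have sb b : \sum_(p <- l | head (~~ b) p == b) 2 ^ (t.+1 - size p) <= 2 ^ t.
  have -> : \sum_(p <- l | head (~~ b) p == b) 2 ^ (t.+1 - size p) =
      \sum_(p <- lb b) 2 ^ (t - size p).
    rewrite /lb big_map big_filter big_seq_cond [RHS]big_seq_cond.
    apply: eq_bigr => p /andP[pl _]; case: p pl => [h|c p _]; last by rewrite subSS.
    by rewrite h in nnl.
  apply: IH.
  - rewrite map_inj_in_uniq ?filter_uniq // => p q; rewrite !mem_filter.
    move=> /andP[/eqP hp pl] /andP[/eqP hq ql].
    case: p hp pl => [|c p] hp pl; first by rewrite pl in nnl.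
    case: q hq ql => [|c' q] hq ql; first by rewrite ql in nnl.
    by move: hp hq => /= -> -> ->.
  - move=> p q /hlb pl /hlb ql pq.
    by have := pf _ _ pl ql; rewrite /= eqxx => /(_ pq) [].
  - by apply/allP => p /hlb /hl.
rewrite (bigID (fun p => head false p == true)) /= expnS mul2n -addnn.
apply: leq_add; first exact: (sb true).
apply: leq_trans (sb false); rewrite big_seq_cond [X in _ <= X]big_seq_cond.
apply: eq_leq; apply: eq_bigl => p; case pl : (p \in l) => //=.
case: p pl => [h|c p _]; first by rewrite h in nnl.
by case: c.
Qed.

Local Open Scope classical_set_scope.
Local Open Scope ring_scope.

(** * The halting probability and its approximations *)

Definition wt (R : realType) (l : seq str) : R := \sum_(p <- l) 2^-1 ^+ size p.

Lemma wt_nat (R : realType) t (l : seq str) : all (fun p => size p <= t)%N l ->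
  2 ^+ t * wt R l = (\sum_(p <- l) 2 ^ (t - size p))%N%:R.
Proof.
move=> /allP hl; rewrite /wt mulr_sumr natr_sum big_seq_cond [RHS]big_seq_cond.
apply: eq_bigr => p /andP[/hl pt _].
by rewrite natrX -{1}(subnK pt) exprD exprVn mulfK // expf_neq0.
Qed.

Lemma half_pow_gt0 (R : realType) n : 0 < 2^-1 ^+ n :> R.
Proof. by rewrite exprn_gt0 // invr_gt0. Qed.

Lemma half_pow_le (R : realType) m n :
  (2^-1 ^+ n <= 2^-1 ^+ m :> R) = (m <= n)%N.
Proof. by rewrite ler_iXn2l // ?invr_gt0 // invf_lt1 // ltr1n. Qed.

Lemma half_powK (R : realType) n : 2 ^+ n * 2^-1 ^+ n = 1 :> R.
Proof. by rewrite -exprMn mulfV // expr1n. Qed.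

Section HaltingProbability.
Variables (R : realType) (V : str -> option str).
Hypothesis pfV : prefix_free (dom V).

Lemma wt_le1 l : uniq l -> {in l, forall p, dom V p} -> wt R l <= 1.
Proof.
move=> ul lV; set t := sumn [seq size p | p <- l].
have lt : all (fun p => size p <= t)%N l.
  apply/allP => p; rewrite /t; elim: (l) => //= a s IH.
  by rewrite inE => /orP[/eqP ->|/IH/leq_trans]; rewrite ?leq_addr //; apply; rewrite leq_addl.
rewrite -(ler_pM2l (_ : 0 < 2 ^+ t)) ?exprn_gt0 // mulr1 wt_nat // -natrX ler_nat.
apply: kraft_nat => // p q pl ql; apply: pfV; exact: lV.
Qed.

Let E : \bar R := \esum_(p in dom V) (2^-1 ^+ size p)%:E.

Lemma fsum_wt (X : set str) : finite_set X -> X `<=` dom V ->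
  exists l, [/\ uniq l, {in l, forall p, dom V p} &
    (\sum_(p \in X) (2^-1 ^+ size p : R)%:E)%E = (wt R l)%:E].
Proof.
move=> fX XV; exists (finmap.enum_fset (fset_set X)); split; first exact: finmap.fset_uniq.
  by move=> p; rewrite in_fset_set // inE => /XV.
by rewrite fsbig_finite //= sumEFin.
Qed.

Lemma esum_ge_wt l : uniq l -> {in l, forall p, dom V p} -> ((wt R l)%:E <= E)%E.
Proof.
move=> ul lV; apply: esum_ge; exists [set` l].
  by split=> //= p; apply: lV.
by rewrite -fsbig_seq //= sumEFin.
Qed.

Lemma OmegaE : (Omega R V)%:E = E.
Proof.
rewrite /Omega -/E fineK // ge0_fin_numE; last first.
  by apply: esum_ge0 => p _; rewrite lee_fin ltW // half_pow_gt0.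
apply: (@le_lt_trans _ _ 1%:E); last by rewrite ltry.
apply: ge_ereal_sup => _ [X [fX XV] <-].
by have [l [ul lV ->]] := fsum_wt fX XV; rewrite lee_fin wt_le1.
Qed.

Lemma wt_le_Omega l : uniq l -> {in l, forall p, dom V p} -> wt R l <= Omega R V.
Proof. by move=> ul lV; rewrite -lee_fin OmegaE esum_ge_wt. Qed.

Lemma Omega_le1 : Omega R V <= 1.
Proof.
rewrite -lee_fin OmegaE; apply: ge_ereal_sup => _ [X [fX XV] <-].
by have [l [ul lV ->]] := fsum_wt fX XV; rewrite lee_fin wt_le1.
Qed.

Lemma Omega_ge0 : 0 <= Omega R V.
Proof. by have := @wt_le_Omega [::] isT; rewrite /wt big_nil; apply. Qed.

Lemma lt_OmegaP x : x < Omega R V ->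
  exists l, [/\ uniq l, {in l, forall p, dom V p} & x < wt R l].
Proof.
rewrite -lte_fin OmegaE => /ereal_sup_gt[_ [X [fX XV] <-]].
by have [l [ul lV ->]] := fsum_wt fX XV; rewrite lte_fin => ?; exists l.
Qed.

Variable M : oracle_tm.
Hypothesis VM : forall x y, V x = Some y <-> exists t, out M [::] x t = Some y.

Lemma dl_dom t p : p \in dl M t -> dom V p.
Proof.
rewrite mem_dl => /andP[_]; case e : (out _ _ _ _) => [y|] // _.
by rewrite /dom /=; have -> : V p = Some y by apply/VM; exists t.
Qed.

Lemma dom_dl p : dom V p -> exists T, forall t, (T <= t)%N -> p \in dl M t.
Proof.
rewrite /dom /=; case e : (V p) => [y|] // _.
have /VM[T hT] := e; exists (maxn T (size p)) => t; rewrite geq_max => /andP[h1 h2].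
by rewrite mem_dl h2 (out_mono h1 hT).
Qed.

Definition om t := wt R (dl M t).

Lemma om_weight t : 2 ^+ t * om t = (weight M t)%:R.
Proof.
rewrite /om wt_nat; last by apply/allP => p; rewrite mem_dl => /andP[].
by congr _%:R; rewrite /weight sumnE big_map.
Qed.

Lemma om_le t : om t <= Omega R V.
Proof. by apply: wt_le_Omega; [exact: uniq_dl | exact: dl_dom]. Qed.

(** A program that halts later adds its weight to what is already there. *)
Lemma om_new t q : dom V q -> q \notin dl M t -> om t + 2^-1 ^+ size q <= Omega R V.
Proof.
move=> qV qt; have -> : om t + 2^-1 ^+ size q = wt R (q :: dl M t).
  by rewrite /om /wt big_cons addrC.
apply: wt_le_Omega; first by rewrite /= qt uniq_dl.
by move=> p; rewrite inE => /orP[/eqP -> //|]; apply: dl_dom.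
Qed.

Lemma wt_sub (l l' : seq str) : uniq l -> {subset l <= l'} -> uniq l' -> wt R l <= wt R l'.
Proof.
move=> ul ll' ul'; rewrite /wt [X in _ <= X](bigID (mem l)) /=.
have -> : \sum_(p <- l) 2^-1 ^+ size p = \sum_(p <- l' | p \in l) 2^-1 ^+ size p :> R.
  rewrite -[RHS]big_filter; apply: perm_big; apply: uniq_perm => //.
    exact: filter_uniq.
  by move=> p; rewrite mem_filter; case pl : (p \in l) => //=; rewrite ll'.
by rewrite lerDl sumr_ge0 // => p _; rewrite ltW // half_pow_gt0.
Qed.

Lemma om_mono t t' : (t <= t')%N -> om t <= om t'.
Proof. by move=> le; apply: wt_sub; [exact: uniq_dl|exact: dl_mono|exact: uniq_dl]. Qed.

Lemma eventually_all (T : eqType) (l : seq T) (P : T -> nat -> Prop) :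
  {in l, forall x, exists n, forall t, (n <= t)%N -> P x t} ->
  exists n, forall t, (n <= t)%N -> {in l, forall x, P x t}.
Proof.
elim: l => [|a l IH] h; first by exists 0%N.
have [n1 h1] : exists n, forall t, (n <= t)%N -> {in l, forall x, P x t}.
  by apply: IH => x xl; apply: h; rewrite inE xl orbT.
have [n2 h2] := h a (mem_head _ _).
exists (maxn n1 n2) => t; rewrite geq_max => /andP[le1 le2] x.
by rewrite inE => /orP[/eqP ->|]; [apply: h2 | apply: h1].
Qed.

(** Finitely many programs weigh more than [x], and all of them are found by some
    stage. *)
Lemma om_lim x : x < Omega R V -> exists T, forall t, (T <= t)%N -> x < om t.
Proof.
move=> /lt_OmegaP[l [ul lV xl]].
have [T hT] := @eventually_all _ l (fun p t => p \in dl M t) (fun p pl => dom_dl (lV p pl)).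
exists T => t /hT h; apply: lt_le_trans xl _.
by apply: wt_sub => //; exact: uniq_dl.
Qed.

Lemma floP n t : (flo M n t)%:R <= 2 ^+ n * om t < (flo M n t).+1%:R.
Proof.
have e : 2 ^+ n * om t = (2 ^ n * weight M t)%N%:R / 2 ^+ t.
  by rewrite natrM natrX -om_weight [2 ^+ t * _]mulrC mulrA mulfK // expf_neq0.
rewrite e ler_pdivlMr ?exprn_gt0 // ltr_pdivrMr ?exprn_gt0 //.
rewrite -!natrX -!natrM ler_nat ltr_nat leq_trunc_div /=.
by rewrite ltn_ceil // expn_gt0.
Qed.

(** The first [n] binary digits of [Omega], as a number. *)
Definition tf n := Num.truncn (2 ^+ n * Omega R V).

Lemma tfP n : (tf n)%:R <= 2 ^+ n * Omega R V < (tf n).+1%:R.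
Proof. by rewrite /tf truncn_itv // mulr_ge0 ?exprn_ge0 // Omega_ge0. Qed.

Lemma flo_le_tf n t : (flo M n t <= tf n)%N.
Proof.
rewrite -ltnS -(ltr_nat R); have /andP[h1 _] := floP n t.
apply: le_lt_trans h1 _; have /andP[_ h2] := tfP n; apply: le_lt_trans h2.
by rewrite ler_wpM2l ?om_le // exprn_ge0.
Qed.

Lemma flo_mono n t t' : (t <= t')%N -> (flo M n t <= flo M n t')%N.
Proof.
move=> le; rewrite -ltnS -(ltr_nat R); have /andP[h1 _] := floP n t.
apply: le_lt_trans h1 _; have /andP[_ h2] := floP n t'; apply: le_lt_trans h2.
by rewrite ler_wpM2l ?om_mono // exprn_ge0.
Qed.

End HaltingProbability.

Local Open Scope classical_set_scope.
Local Open Scope ring_scope.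

(** * Binary expansions of numbers that are not dyadic *)

Lemma half_pow_small (R : realType) (e : R) : 0 < e -> exists n, 2^-1 ^+ n < e.
Proof.
move=> e0; exists (Num.bound e^-1).
rewrite exprVn -[ltRHS]invrK ltf_pV2 ?posrE ?exprn_gt0 ?invr_gt0 //.
exact: upper_nthrootP.
Qed.

Lemma half_pow_double (R : realType) n : 2^-1 ^+ n = 2 * 2^-1 ^+ n.+1 :> R.
Proof. by rewrite exprS mulrA mulfV // mul1r. Qed.

Section BinaryExpansion.
Variables (R : realType) (a : R).
Hypotheses (a0 : 0 <= a) (a1 : a <= 1).
Hypothesis nondyadic : forall n m, 2 ^+ n * a <> m%:R.

Let T n := Num.truncn (2 ^+ n * a).

Lemma digitsP n : (T n)%:R < 2 ^+ n * a < (T n).+1%:R.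
Proof.
have /andP[h1 h2] : (T n)%:R <= 2 ^+ n * a < (T n).+1%:R.
  by rewrite /T truncn_itv // mulr_ge0 ?exprn_ge0.
by rewrite h2 andbT lt_neqAle h1 andbT; apply/eqP => /esym/nondyadic.
Qed.

Lemma fractional_part : a - (Num.floor a)%:~R = a.
Proof.
have -> : Num.floor a = 0.
  apply: floor_def; rewrite a0 /= add0r lt_neqAle a1 andbT; apply/eqP => e.
  by apply: (@nondyadic 0 1); rewrite expr0 mul1r e.
by rewrite subr0.
Qed.

Lemma digits_half n : (T n.+1)./2 = T n.
Proof.
have /andP[h1 h2] := digitsP n; have /andP[h3 h4] := digitsP n.+1.
have e : 2 ^+ n.+1 * a = 2 * (2 ^+ n * a) by rewrite exprS mulrA.
have k1 : ((T n).*2 < (T n.+1).+1)%N.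
  rewrite -(ltr_nat R); apply: lt_trans h4; rewrite e -mul2n natrM.
  by rewrite ltr_pM2l.
have k2 : ((T n.+1) < (T n).+1.*2)%N.
  rewrite -(ltr_nat R); apply: lt_trans h3 _; rewrite e -mul2n natrM.
  by rewrite ltr_pM2l.
apply/eqP; rewrite eqn_leq; apply/andP; split.
  by rewrite -ltnS ltn_half_double.
by rewrite -[leqLHS]doubleK half_leq.
Qed.

Let S (b : nat -> bool) := series (fun k => (b k)%:R / 2 ^+ k.+1 : R).

Lemma partial_binval b n : 2 ^+ n * S b n = (binval (mkseq b n))%:R.
Proof.
elim: n => [|n IH]; first by rewrite /S /series /= big_geq // mulr0.
rewrite /mkseq -[n.+1]addn1 iotaD map_cat /= cats1 binval_rcons addn1 add0n.
rewrite /S seriesSr -/(S b) mulrDr exprS -mulrA IH natrD -mul2n natrM.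
by congr (_ + _); rewrite mulrC divfK // -exprS expf_neq0.
Qed.

Lemma partial_mono b : nondecreasing_seq (S b).
Proof.
apply/nondecreasing_seqP => n; rewrite /S seriesSr lerDl.
by rewrite divr_ge0 // exprn_ge0.
Qed.

Lemma partial_tail b n m : S b (n + m)%N <= S b n + 2^-1 ^+ n - 2^-1 ^+ (n + m)%N.
Proof.
elim: m => [|m IH]; first by rewrite addn0 addrK.
rewrite addnS /S seriesSr -!/(S b).
have hb : (b (n + m)%N)%:R / 2 ^+ (n + m)%N.+1 <= 2^-1 ^+ (n + m)%N.+1 :> R.
  by rewrite -exprVn ler_piMl ?exprn_ge0 ?invr_ge0 // lern1 leq_b1.
have := half_pow_double R (n + m)%N; move: IH hb; lra.
Qed.

(** The [n]-th partial sum of an expansion is at most [2 ^- n] below [a], because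
    the remaining digits weigh no more; it is strictly less than that below [a],
    because [a] is not dyadic, and this determines its numerator. *)
Lemma expansion_digits b n :
  is_binary_expansion a b -> mkseq b n = bits n (T n).
Proof.
rewrite /is_binary_expansion fractional_part -/(S b) => -[cv _].
have cvS : cvgn (S b) by apply/cvg_ex; exists a.
have lim : limn (S b) = a by exact: cvg_lim cv.
have h1 : S b n <= a.
  by rewrite -lim; apply: nondecreasing_cvgn_le => //; exact: partial_mono.
have h2 : a <= S b n + 2^-1 ^+ n.
  rewrite -lim; apply: limr_le => //; exists n => // m /= nm.
  rewrite -(subnKC nm); apply: le_trans (partial_tail _ _ _) _.
  by rewrite gerDl oppr_le0 exprn_ge0 // invr_ge0.
have /andP[h3 h4] := digitsP n.
have e : binval (mkseq b n) = T n.
  rewrite /T; apply/esym/truncn_def; rewrite -!partial_binval ler_pM2l ?exprn_gt0 // h1 /=.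
  rewrite -[ltRHS]natr1 -partial_binval -[X in _ + X](half_powK _ n) -mulrDr.
  rewrite lt_neqAle ler_pM2l ?exprn_gt0 // h2 andbT mulrDr half_powK partial_binval natr1.
  by apply/eqP; exact: nondyadic.
by rewrite -e -{2}(size_mkseq b n) binvalK.
Qed.

(** If the digits were all one from some place on, the partial sums would approach
    a dyadic number above [a]. *)
Lemma digits_expansion : is_binary_expansion a (fun k => odd (T k.+1)).
Proof.
set b := fun k => odd (T k.+1).
have T0 : T 0 = 0%N.
  rewrite /T; apply/truncn_def; rewrite expr0 mul1r a0 /= lt_neqAle a1 andbT.
  by apply/eqP => e; apply: (@nondyadic 0 1); rewrite expr0 mul1r e.
have e n : 2 ^+ n * S b n = (T n)%:R.
  rewrite partial_binval; congr _%:R; elim: n => [|n IH]; first by rewrite T0.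
  rewrite /mkseq -[n.+1]addn1 iotaD map_cat /= cats1 binval_rcons addn1 add0n IH.
  by rewrite /b -digits_half addnC odd_double_half.
have lo n : S b n < a.
  rewrite -(ltr_pM2l (_ : 0 < 2 ^+ n)) ?exprn_gt0 // e.
  by case/andP: (digitsP n).
have hi n : a < S b n + 2^-1 ^+ n.
  rewrite -(ltr_pM2l (_ : 0 < 2 ^+ n)) ?exprn_gt0 // mulrDr half_powK e natr1.
  by case/andP: (digitsP n).
split.
  rewrite fractional_part -/(S b); apply/cvgrPdist_le => x x0.
  have [n hn] := half_pow_small x0; exists n => // m /= nm.
  rewrite ger0_norm; last by rewrite subr_ge0 ltW.
  apply: ltW; apply: le_lt_trans hn; rewrite lerBlDr addrC.
  apply: le_trans (ltW (hi m)) _; rewrite lerD2l half_pow_le //.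
move=> n; apply: contrapT => no.
have all1 m : (n <= m)%N -> b m = true.
  by move=> nm; case bm : (b m) => //; case: no; exists m.
have := hi n; rewrite -subr_gt0 => /half_pow_small[m hm].
have tail : S b (n + m)%N = S b n + 2^-1 ^+ n - 2^-1 ^+ (n + m)%N.
  elim: (m) => [|j IH]; first by rewrite addn0 addrK.
  rewrite addnS /S seriesSr -!/(S b) IH all1 ?leq_addr // mul1r -exprVn.
  have := half_pow_double R (n + j)%N; lra.
have := lo (n + m)%N; rewrite tail ltrBlDr -ltrBlDl; apply/negP; rewrite -leNgt.
by apply: le_trans (ltW hm); rewrite half_pow_le leq_addl.
Qed.

Lemma bit_prefixE n : bit_prefix a n = bits n (T n).
Proof.
apply: expansion_digits; apply: (@getPex _ (is_binary_expansion a)).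
by exists (fun k => odd (T k.+1)); exact: digits_expansion.
Qed.

End BinaryExpansion.

Lemma header_prefix p q : prefix p q -> false \in p ->
  index false q = index false p /\
  prefix (drop (index false p).+1 p) (drop (index false q).+1 q).
Proof.
move=> /prefixP[r ->] fp; rewrite index_cat fp; split=> //.
rewrite drop_cat; case: ltnP => h; first exact: prefix_prefix.
by rewrite [drop _ p]drop_oversize // prefix0s.
Qed.

(** * Forcing an optimal machine to halt *)

Lemma optimal_search V (P : str -> nat -> bool) (u : str -> nat -> str) :
  optimal V ->
  comp (fun v : str * nat => P v.1 v.2) -> comp (fun v : str * nat => u v.1 v.2) ->
  (forall p q t t', P p t -> P q t' -> prefix p q -> p = q) ->
  exists d, forall q t, P q t -> (forall k, (k < t)%N -> ~~ P q k) ->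
    exists q', [/\ dom V q', V q' = Some (u q t) & (size q' <= size q + d)%N].
Proof.
move=> [_ opt] hP hu pf.
pose F x := if pselect (exists t, P x t) is left ex then Some (u x (ex_minn ex)) else None.
have FE x y : F x = Some y <->
    exists t, [/\ P x t, forall k, (k < t)%N -> ~~ P x k & u x t = y].
  rewrite /F; case: pselect => [ex|no]; last first.
    by split=> // -[t [Pt _ _]]; case: no; exists t.
  case: ex_minnP => m Pm mmin; split=> [[<-]|[t [Pt nP <-]]].
    by exists m; split=> // k; rewrite ltnNge; apply: contra => /mmin.
  congr Some; congr u; apply/eqP; rewrite eqn_leq mmin // leqNgt.
  by apply/negP => /nP; rewrite Pm.
have Fdom x : dom F x -> exists t, P x t.
  rewrite /dom /=; case e : (F x) => [y|] // _.
  by have /FE[t [Pt _ _]] := e; exists t.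
have [|d hd] := opt F.
  split; first exact: search_machine hP hu FE.
  by move=> p q /Fdom[t Pt] /Fdom[t' Pt']; exact: pf Pt Pt'.
exists d => q t Pt nP.
have e : F q = Some (u q t) by apply/FE; exists t.
have [|q' [h1 h2 h3]] := hd q; first by rewrite /dom /= e.
by exists q'; rewrite h2 e.
Qed.

Section Kick.
Variables (R : realType) (V : str -> option str) (M : oracle_tm).
Hypothesis optV : optimal V.
Hypothesis VM : forall x y, V x = Some y <-> exists t, out M [::] x t = Some y.

Let pfV : prefix_free (dom V). Proof. by case: optV => -[]. Qed.

(** An output longer than everything that [V] has put out by stage [t] forces
    a new, short program into the domain of [V] after that stage. *)
Lemma kick (P : str -> nat -> bool) :
  comp (fun v : str * nat => P v.1 v.2) ->
  (forall p q t t', P p t -> P q t' -> prefix p q -> p = q) ->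
  exists d, forall q t, P q t -> (forall k, (k < t)%N -> ~~ P q k) ->
    om R M t + 2^-1 ^+ (size q + d)%N <= Omega R V.
Proof.
move=> hP pf.
pose u (q : str) t := nseq (output_bound M t).+1 true.
have hu : comp (fun v : str * nat => u v.1 v.2) by rewrite /u; comp_tac.
have [d hd] := optimal_search optV hP hu pf.
exists d => q t Pt nP; have [q' [h1 h2 h3]] := hd q t Pt nP.
suff qt : q' \notin dl M t.
  apply: (le_trans _ (om_new R pfV VM h1 qt)).
  by rewrite lerD2l half_pow_le.
apply/negP => qt.
have [y e] : exists y, out M [::] q' t = Some y.
  by move: qt; rewrite mem_dl => /andP[_]; case: (out _ _ _ _) => // y; exists y.
have := output_boundP qt e.
have /eqP : V q' = Some y by apply/VM; exists t.
by rewrite h2 => /eqP[<-]; rewrite size_nseq ltnn.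
Qed.

(** If [Omega] were a known dyadic number, one could wait until it is almost
    exhausted and then push it beyond its value. *)
Lemma Omega_nondyadic n m : 2 ^+ n * Omega R V <> m%:R.
Proof.
move=> Om.
pose P (q : str) t := [&& false \in q, drop (index false q).+1 q == [::] &
  (m * 2 ^ (index false q).*2 <= (flo M (n + (index false q).*2) t).+1)%N].
have hP : comp (fun v : str * nat => P v.1 v.2) by rewrite /P; comp_tac.
have sizeq q : false \in q -> size q = ((index false q).+1 + size (drop (index false q).+1 q))%N.
  by move=> h; rewrite size_drop subnKC // index_mem.
have [|d hd] := kick hP.
  move=> p q t t' /and3P[fp dp _] /and3P[fq dq _] pq.
  have [e _] := header_prefix pq fp; apply/eqP.
  have := pq; rewrite prefixE => /eqP <-.
  have -> : size p = size q by rewrite (sizeq p fp) (sizeq q fq) (eqP dp) (eqP dq) e.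
  by rewrite take_size.
(* The gap [2 ^- (n + 2 * j)] has to be smaller than the push [2 ^- (j + 1 + d)]. *)
pose j := d.+2; pose q := rcons (nseq j true) false.
have fq : false \in q by rewrite mem_rcons inE.
have iq : index false q = j.
  rewrite /q -cats1 index_cat mem_nseq andbF size_nseq /= addn0 //.
have [t0 ht0] : exists t, P q t.
  have lt : Omega R V - 2^-1 ^+ (n + j.*2) < Omega R V by rewrite ltrBlDr ltrDl half_pow_gt0.
  have [T /(_ T (leqnn _)) hT] := om_lim pfV VM lt.
  exists T; apply/and3P; split=> //.
    by rewrite iq drop_oversize // size_rcons size_nseq.
  rewrite iq -ltnS -(ltr_nat R).
  have /andP[_ h] := floP R M (n + j.*2) T.
  have eN : 2 ^+ (n + j.*2) * Omega R V = (m * 2 ^ j.*2)%N%:R.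
    by rewrite exprD mulrAC Om natrM natrX.
  have : 2 ^+ (n + j.*2) * (Omega R V - 2^-1 ^+ (n + j.*2)) < 2 ^+ (n + j.*2) * om R M T.
    by rewrite ltr_pM2l ?exprn_gt0.
  rewrite mulrBr half_powK eN => h'; rewrite -[ltRHS]natr1; move: h h'; lra.
have [t Pt tmin] := ex_minnP (ex_intro _ t0 ht0).
have nP k : (k < t)%N -> ~~ P q k by rewrite ltnNge; apply: contra => /tmin.
have hk := hd q t Pt nP.
have /and3P[_ _] := Pt; rewrite iq => hm.
have hO : Omega R V <= om R M t + 2^-1 ^+ (n + j.*2).
  have /andP[h _] := floP R M (n + j.*2) t.
  rewrite -(ler_pM2l (_ : 0 < 2 ^+ (n + j.*2))) ?exprn_gt0 // mulrDr half_powK.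
  have -> : 2 ^+ (n + j.*2) * Omega R V = (m * 2 ^ j.*2)%N%:R.
    by rewrite exprD mulrAC Om natrM natrX.
  apply: (@le_trans _ _ (flo M (n + j.*2) t).+1%:R); first by rewrite ler_nat.
  by rewrite -natr1 lerD2r.
have := le_trans hk hO; rewrite lerD2l half_pow_le size_rcons size_nseq.
by apply/negP; rewrite -ltnNge /j -addnn; lia.
Qed.

Let nd := Omega_nondyadic.

(** A number that is not dyadic lies strictly above its first [n] digits, so that
    approximations from below eventually pass these. *)
Lemma flo_tf n : exists T, forall t, (T <= t)%N -> flo M n t = tf R V n.
Proof.
have lt : (tf R V n)%:R / 2 ^+ n < Omega R V.
  rewrite ltr_pdivrMr ?exprn_gt0 // mulrC.
  have /andP[h _] := tfP R pfV n.
  by rewrite lt_neqAle h andbT; apply/eqP => /esym; exact: nd.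
have [T hT] := om_lim pfV VM lt; exists T => t /hT.
rewrite ltr_pdivrMr ?exprn_gt0 // mulrC => h.
apply/eqP; rewrite eqn_leq (flo_le_tf R pfV VM) -ltnS -(ltr_nat R).
by apply: lt_trans h _; case/andP: (floP R M n t).
Qed.

Lemma tf_lt n : (tf R V n < 2 ^ n)%N.
Proof.
rewrite -(ltr_nat R) natrX; have /andP[h _] := tfP R pfV n.
apply: le_lt_trans h _; rewrite -[ltRHS]mulr1 ltr_pM2l ?exprn_gt0 //.
rewrite lt_neqAle Omega_le1 // andbT; apply/eqP => e.
by apply: (@nd 0 1); rewrite expr0 mul1r e.
Qed.

Lemma mem_Pf x : (x \in Pf (Omega R V)) = (x == bits (size x) (tf R V (size x))).
Proof.
have e n : bit_prefix (Omega R V) n = bits n (tf R V n).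
  by apply: bit_prefixE => //; [exact: Omega_ge0 | exact: Omega_le1].
apply/idP/eqP => [|->]; rewrite inE.
  by move=> [n _ <-]; rewrite e size_bits.
by exists (size x) => //; rewrite e.
Qed.

End Kick.

Local Open Scope classical_set_scope.
Local Open Scope ring_scope.

(** * From summability to a reduction *)

Lemma two_powB (R : realType) n m :
  (2 : R) ^ (n%:Z - m%:Z) = 2 ^+ n * 2^-1 ^+ m.
Proof. by rewrite expfzDr // -exprnN exprVn. Qed.

Lemma summable_bound (R : realType) (f : nat -> nat) :
  (\sum_(0 <= n <oo) ((2 : R) ^ (n%:Z - (f n)%:Z))%:E < +oo)%E ->
  exists c, forall n, \sum_(0 <= m < n) 2 ^+ m * 2^-1 ^+ f m <= 2 ^+ c :> R.
Proof.
set S := (\sum_(0 <= n <oo) _)%E => Slt.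
have t0 n : (0 <= ((2 : R) ^ (n%:Z - (f n)%:Z))%:E)%E.
  by rewrite lee_fin two_powB mulr_ge0 ?exprn_ge0 ?invr_ge0.
have S0 : (0 <= S)%E by apply: nneseries_ge0.
have e : S = (fine S)%:E by rewrite fineK // ge0_fin_numE.
exists (Num.bound (fine S)) => n.
apply: ltW; apply: le_lt_trans (upper_nthrootP (leqnn _)).
rewrite -lee_fin -e; apply: le_trans (nneseries_lim_ge n _) => //.
rewrite sumEFin lee_fin le_eqVlt; apply/orP; left; apply/eqP.
by apply: eq_bigr => m _; rewrite two_powB.
Qed.

Section Coding.
Variable l : nat -> nat.
Hypothesis l_mono : {homo l : m n / (m <= n)%N}.

(** The requests of [2 ^ m] codewords of length [l m], for [m < n], use up this
    many of the strings of length [l n], taken in lexicographic order. *)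
Definition pos n := sumn [seq (2 ^ (m + (l n - l m)))%N | m <- iota 0 n].

Lemma posE n : pos n = (\sum_(0 <= m < n) 2 ^ (m + (l n - l m)))%N.
Proof. by rewrite /pos sumnE big_map /index_iota subn0. Qed.

(** The codewords for [n'] come after everything that extends a codeword for a
    smaller [n]. *)
Lemma pos_lt n n' : (n < n')%N ->
  ((pos n + 2 ^ n) * 2 ^ (l n' - l n) <= pos n')%N.
Proof.
move=> lt; rewrite !posE [leqRHS](big_cat_nat (n := n.+1)) //=.
apply: leq_trans (leq_addr _ _); rewrite mulnDl big_nat_recr //= big_distrl /=.
apply: leq_add; last by rewrite expnD.
rewrite big_seq_cond [X in (_ <= X)%N]big_seq_cond; apply: leq_sum => m.
rewrite mem_index_iota andbT /= => mn; rewrite -expnD leq_exp2l //.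
have := l_mono (ltnW mn); have := l_mono (ltnW lt); lia.
Qed.

Definition coded (q : str) n := [&& size q == l n, (pos n <= binval q)%N &
  (binval q < pos n + 2 ^ n)%N].

Lemma coded_lt p q n n' : coded p n -> coded q n' -> prefix p q -> ~~ (n < n')%N.
Proof.
move=> /and3P[/eqP sp _ p2] /and3P[/eqP sq q1 _] pq; apply/negP => lt.
have /andP[_] := binval_prefix pq; rewrite ltnNge sp sq => /negP; apply.
apply: leq_trans q1; apply: leq_trans (pos_lt lt).
by rewrite leq_mul2r p2 orbT.
Qed.

Lemma coded_prefix p q n n' : coded p n -> coded q n' -> prefix p q -> p = q.
Proof.
move=> cp cq pq; have := coded_lt cp cq pq; rewrite -leqNgt => le.
have /and3P[/eqP sp _ _] := cp; have /and3P[/eqP sq _ _] := cq.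
have sqp : (size q <= size p)%N by rewrite sp sq; apply: l_mono.
by have := pq; rewrite prefixE take_oversize // => /eqP.
Qed.

Lemma coded_inj q n n' : coded q n -> coded q n' -> n = n'.
Proof.
move=> c c'; apply/eqP; rewrite eqn_leq.
have := coded_lt c c' (prefix_refl q); have := coded_lt c' c (prefix_refl q).
by rewrite -!leqNgt => -> ->.
Qed.

Lemma pos_sum (R : realType) n :
  (pos n + 2 ^ n)%N%:R = 2 ^+ l n * \sum_(0 <= m < n.+1) 2 ^+ m * 2^-1 ^+ l m :> R.
Proof.
rewrite big_nat_recr //= mulrDr natrD; congr (_ + _); last first.
  by rewrite mulrCA half_powK mulr1 natrX.
rewrite posE natr_sum mulr_sumr big_seq_cond [RHS]big_seq_cond; apply: eq_bigr => m.
rewrite mem_index_iota andbT /= => mn; rewrite natrX exprD mulrCA.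
by rewrite -{2}(subnK (l_mono (ltnW mn))) exprD -mulrA half_powK mulr1.
Qed.

(** As long as the weights add up to at most one, there is room for all the
    codewords. *)
Lemma pos_bound (R : realType) n :
  \sum_(0 <= m < n.+1) 2 ^+ m * 2^-1 ^+ l m <= 1 :> R ->
  (pos n + 2 ^ n <= 2 ^ l n)%N.
Proof.
by move=> h; rewrite -(ler_nat R) pos_sum natrX ler_piMr // exprn_ge0.
Qed.

Hypothesis comp_l : comp l.

Lemma comp_pos X {eX : Enc X} (n : X -> nat) : comp n -> comp (fun x => pos (n x)).
Proof.
move=> hn; apply: comp_sumn.
apply: (comp_map (h := fun x m => (2 ^ (m + (l (n x) - l m)))%N)); last by comp_tac.
have h1 : comp (fun u : X * nat => l (n u.1)).
  by apply: (comp_comp comp_l); apply: (comp_comp hn); comp_tac.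
by comp_tac.
Qed.

End Coding.

Section Reduction.
Variables (R : realType) (V W : str -> option str).
Hypotheses (optV : optimal V) (optW : optimal W).

(** The codeword of length [f n + c] for the first [n] digits of [Omega] halts
    with a stage at which these digits are correct.  Hence [W] prints such a stage
    on some short program, and since later stages are correct too, whatever the
    other programs of [W] print can be added to it. *)
Lemma reducible_of_summable (f : nat -> nat) : order_function f ->
  (\sum_(0 <= n <oo) ((2 : R) ^ (n%:Z - (f n)%:Z))%:E < +oo)%E ->
  exists c, reducible_in_query_size (fun n => (f n + c)%N) (Pf (Omega R V)) (dom W).
Proof.
move=> [f_mono /total_recursive_comp hf _] /summable_bound[c1 hc1].
have [[[prV pfV] _] [[prW _] _]] := (optV, optW).
have [MV VM] := partial_recursive_out prV.
have [MW WM] := partial_recursive_out prW.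
pose l n := (f n + c1)%N.
have l_mono : {homo l : m n / (m <= n)%N} by move=> m n mn; rewrite leq_add2r f_mono.
have comp_l : comp l by rewrite /l; comp_tac.
have hpos n : (pos l n + 2 ^ n <= 2 ^ l n)%N.
  apply: (@pos_bound _ l_mono R).
  have -> : \sum_(0 <= m < n.+1) 2 ^+ m * 2^-1 ^+ l m =
      (\sum_(0 <= m < n.+1) 2 ^+ m * 2^-1 ^+ f m) * 2^-1 ^+ c1 :> R.
    by rewrite mulr_suml; apply: eq_bigr => m _; rewrite exprD mulrA.
  by rewrite exprVn ler_pdivrMr ?exprn_gt0 // mul1r.
pose P (q : str) t := has (fun n => coded l q n &&
   (binval q - pos l n <= flo MV n t)%N) (iota 0 t).
pose u (q : str) t := nseq t true.
have hP : comp (fun v : str * nat => P v.1 v.2).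
  apply: (comp_has (h := fun (v : str * nat) n => coded l v.1 n &&
     (binval v.1 - pos l n <= flo MV n v.2)%N)); last by comp_tac.
  have h1 : comp (fun v : str * nat * nat => pos l v.2) by apply: comp_pos; comp_tac.
  have h2 : comp (fun v : str * nat * nat => l v.2) by comp_tac.
  rewrite /coded; comp_tac.
have hu : comp (fun v : str * nat => u v.1 v.2) by rewrite /u; comp_tac.
have [|d hd] := optimal_search optW hP hu.
  move=> p q t t' /hasP[n _ /andP[cp _]] /hasP[n' _ /andP[cq _]].
  exact: coded_prefix cp cq.
(* [W] prints, on some short program, a stage from which on the digits are right. *)
have stage n : exists q' t0, [/\ dom W q', W q' = Some (nseq t0 true),
    (size q' <= f n + (c1 + d))%N & (tf R V n <= flo MV n t0)%N].
  pose q := bits (l n) (pos l n + tf R V n).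
  have lt : (pos l n + tf R V n < 2 ^ l n)%N.
    by apply: leq_trans (hpos n); rewrite ltn_add2l (tf_lt R optV VM).
  have cq : coded l q n.
    by rewrite /coded /q size_bits eqxx bitsK // leq_addr ltn_add2l (tf_lt R optV VM).
  have ex : exists t, P q t.
    have [T hT] := flo_tf R optV VM n; exists (maxn T n.+1).
    apply/hasP; exists n; first by rewrite mem_iota /= add0n leq_maxr.
    by rewrite cq /q bitsK // addKn hT /= ?leq_maxl.
  have [t Pt tmin] := ex_minnP ex.
  have nP k : (k < t)%N -> ~~ P q k by rewrite ltnNge; apply: contra => /tmin.
  have [q' [h1 h2 h3]] := hd q t Pt nP; exists q', t; split=> //.
    by move: h3; rewrite size_bits addnA.
  have /hasP[n' _ /andP[cq' h]] := Pt.
  by move: h; rewrite (coded_inj l_mono cq' cq) /q bitsK // addKn.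
pose qs (x : str) := strsle (f (size x) + (c1 + d)).
have hqs : comp qs by rewrite /qs; comp_tac.
pose P' (v : str * seq str) t := all (fun p => isSome (out MW [::] p t)) v.2.
pose tmax (v : str * seq str) t :=
  sumn [seq size (odflt [::] (out MW [::] p t)) | p <- v.2].
pose post (v : str * seq str) t := v.1 == bits (size v.1) (flo MV (size v.1) (tmax v t)).
have hP' : comp (fun v : str * seq str * nat => P' v.1 v.2).
  by apply: (comp_all (h := fun (v : str * seq str * nat) p => isSome (out MW [::] p v.2)));
    comp_tac.
have hpost : comp (fun v : str * seq str * nat => post v.1 v.2).
  have h : comp (fun v : str * seq str * nat => tmax v.1 v.2).
    apply: comp_sumn; apply: (comp_map (h := fun (v : str * seq str * nat) p =>
      size (odflt [::] (out MW [::] p v.2)))); comp_tac.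
  by rewrite /post; comp_tac.
exists (c1 + d)%N.
have [|||||M hM hq] := @oracle_machine (dom W) (Pf (Omega R V)) qs P' post.
- exact: hqs.
- exact: hP'.
- exact: hpost.
- move=> x; have [|n hn] := @eventually_all _ (answered (dom W) (qs x))
    (fun p t => isSome (out MW [::] p t)).
    move=> p; rewrite mem_answered => /andP[_]; rewrite inE /dom /=.
    case e : (W p) => [y|] // _; have /WM[T hT] := e; exists T => t le.
    by rewrite (out_mono le hT).
  by exists n; apply/allP; apply: hn.
- move=> x t /allP ht; rewrite (mem_Pf R optV VM) /post /=; congr (_ == bits _ _).
  set n := size x; have [q' [t0 [h1 h2 h3 h4]]] := stage n.
  apply/eqP; rewrite eqn_leq (flo_le_tf R pfV VM) /=; apply: leq_trans h4 _.
  apply: (flo_mono R MV).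
  have q'D : q' \in answered (dom W) (qs x).
    by rewrite mem_answered mem_strsle h3 inE.
  have e : out MW [::] q' t = Some (nseq t0 true).
    have := ht _ q'D; case e : (out _ _ _ _) => [y|] //= _; rewrite -h2.
    by apply/esym/WM; exists t.
  rewrite /tmax /=; elim: (answered _ _) q'D => //= a s IH.
  rewrite inE => /orP[/eqP <-|/IH h]; first by rewrite e /= size_nseq leq_addr.
  exact: leq_trans h (leq_addl _ _).
by exists M => // x q /hq; rewrite mem_strsle.
Qed.

End Reduction.

Local Open Scope nat_scope.

(** * From a reduction to summability *)

Section Kicks.
Variables (MV MW M : oracle_tm) (l : nat -> nat).

(** The part of the oracle that is known at stage [t] and that [M] may see on
    inputs of length [n]. *)
Definition ol n t : seq str := [seq p <- dl MW t | size p <= l n].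

Definition correct n t := all (fun x =>
  isSome (out M (ol n t) x t) &&
  (odflt [::] (out M (ol n t) x t) == [:: x == bits n (flo MV n t)])) (strs n).

(** At stage [t] the reduction, run with the current approximation of its
    oracle, agrees with the current approximations of the first digits. *)
Definition matched N t := all (fun n => correct n t) (iota 0 N.+1).

(** The stages, latest first, at which [Omega] is to be pushed beyond the next
    multiple of [2 ^- N]: stages at which there is a match again after the
    approximation of [Omega] has passed such a multiple. *)
Definition kicks N t : seq nat :=
  foldl (fun K s => if matched N s && all (fun r => flo MV N r < flo MV N s) K
                    then s :: K else K) [::] (iota 0 t).

Lemma kicksS N t : kicks N t.+1 =
  if matched N t && all (fun r => flo MV N r < flo MV N t) (kicks N t)
  then t :: kicks N t else kicks N t.
Proof. by rewrite /kicks -[t.+1]addn1 iotaD foldl_cat. Qed.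

Lemma kicks_mono N t t' : t <= t' -> exists s, kicks N t' = s ++ kicks N t.
Proof.
move=> /subnKC <-; elim: (t' - t) => [|k [s e]]; first by exists [::]; rewrite addn0.
by rewrite addnS kicksS e; case: ifP => _; [exists (t + k :: s) | exists s].
Qed.

Lemma ol_mono n t t' : t <= t' -> {subset ol n t <= ol n t'}.
Proof.
move=> le p; rewrite ![_ \in ol _ _]mem_filter => /andP[-> /=].
exact: dl_mono le _.
Qed.

Lemma uniq_ol n t : uniq (ol n t).
Proof. exact: filter_uniq (uniq_dl _ _). Qed.

Hypothesis flo_lt : forall n t, flo MV n t < 2 ^ n.

(** The same oracle cannot support two different guesses. *)
Lemma correct_eq n t t' : t <= t' -> correct n t -> correct n t' ->
  size (ol n t') <= size (ol n t) -> flo MV n t = flo MV n t'.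
Proof.
move=> le /allP h /allP h' sz.
have [_ eol] := uniq_min_size (uniq_ol n t) (ol_mono le) sz.
have eo : olist (ol n t) = olist (ol n t').
  by apply: funext => p; rewrite /olist eol.
pose x := bits n (flo MV n t).
have xn : x \in strs n by rewrite mem_strs size_bits.
have /andP[] := h _ xn; have /andP[] := h' _ xn; rewrite eqxx.
case e : (out M (ol n t) x t) => [y|] //; case e' : (out M (ol n t') x t') => [y'|] //= _.
move=> /eqP ey' _ /eqP ey.
move: e'; rewrite /out -eo -/(out M (ol n t) x t') (out_mono le e) ey ey' => -[] /esym/eqP.
by rewrite /x => eb; rewrite -(bitsK (flo_lt n t)) eb bitsK.
Qed.

(** Each oracle sees at most [2 ^ (N - n)] pushes, since it fixes the first [n]
    digits; the remainder counts the pushes within the current block. *)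
Lemma kicks_count N n t r K : n <= N -> kicks N t = r :: K ->
  [/\ r < t, matched N r &
   (size K).+1 <= 2 ^ (N - n) * size (ol n r) + flo MV N r %% 2 ^ (N - n) + 1].
Proof.
move=> nN; elim: t r K => // t IH r K; rewrite kicksS; case: ifP; last first.
  by move=> _ /IH[h1 h2 h3]; split=> //; apply: ltnW.
move=> /andP[mt hK] [<- {r} eK]; split=> //.
case: K eK => [_|r K eK]; first by rewrite addn1.
have [rt mr hc] := IH _ _ eK.
have lt : flo MV N r < flo MV N t by move: hK; rewrite eK /= => /andP[].
have cn s : matched N s -> correct n s.
  by move=> /allP; apply; rewrite mem_iota /= add0n ltnS.
have le : size (ol n r) <= size (ol n t).
  by apply: uniq_leq_size (uniq_ol _ _) (ol_mono (ltnW rt)).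
rewrite /= !addn1 !ltnS; apply: leq_trans hc _; rewrite addn1.
have p0 : 0 < 2 ^ (N - n) by rewrite expn_gt0.
case: (ltnP (size (ol n r)) (size (ol n t))) => [lts|ges].
  apply: leq_trans (leq_addr _ _).
  apply: (@leq_trans (2 ^ (N - n) * (size (ol n r)).+1)); last by rewrite leq_pmul2l.
  by rewrite mulnSr -addnS leq_add2l ltn_mod.
have := correct_eq (ltnW rt) (cn _ mr) (cn _ mt) ges.
rewrite (flo_div MV _ nN) (flo_div MV _ nN) => ed.
have -> : size (ol n r) = size (ol n t) by apply/eqP; rewrite eqn_leq le.
rewrite -addnS leq_add2l.
rewrite -(ltn_add2l (flo MV N t %/ 2 ^ (N - n) * 2 ^ (N - n))) -{1}ed.
by rewrite -!divn_eq.
Qed.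

Hypothesis comp_l : comp l.

Lemma comp_ol X {eX : Enc X} (n t : X -> nat) :
  comp n -> comp t -> comp (fun x => ol (n x) (t x)).
Proof.
move=> hn ht; have h : comp (fun x => l (n x)) by apply: (comp_comp comp_l).
by apply: (comp_filter (h := fun x (p : str) => size p <= l (n x))); comp_tac.
Qed.

Lemma comp_matched X {eX : Enc X} (N t : X -> nat) :
  comp N -> comp t -> comp (fun x => matched (N x) (t x)).
Proof.
move=> hN ht; apply: (comp_all (h := fun x n => correct n (t x))); last by comp_tac.
apply: (comp_all (h := fun (u : X * nat) x =>
  isSome (out M (ol u.2 (t u.1)) x (t u.1)) &&
  (odflt [::] (out M (ol u.2 (t u.1)) x (t u.1)) == [:: x == bits u.2 (flo MV u.2 (t u.1))])));
  last by comp_tac.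
have h : comp (fun v : X * nat * str => ol v.1.2 (t v.1.1)) by apply: comp_ol; comp_tac.
by comp_tac.
Qed.

Lemma comp_kicks X {eX : Enc X} (N t : X -> nat) :
  comp N -> comp t -> comp (fun x => kicks (N x) (t x)).
Proof.
move=> hN ht.
apply: (comp_foldl (h := fun x K s =>
  if matched (N x) s && all (fun r => flo MV (N x) r < flo MV (N x) s) K
  then s :: K else K)); [|comp_tac|comp_tac].
have h : comp (fun u : X * seq nat * nat => matched (N u.1.1) u.2).
  by apply: comp_matched; comp_tac.
have h' : comp (fun u : X * seq nat * nat =>
    all (fun r => flo MV (N u.1.1) r < flo MV (N u.1.1) u.2) u.1.2).
  by apply: (comp_all (h := fun (u : X * seq nat * nat) r =>
    flo MV (N u.1.1) r < flo MV (N u.1.1) u.2)); comp_tac.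
by comp_tac.
Qed.

End Kicks.

Local Open Scope classical_set_scope.
Local Open Scope ring_scope.

Lemma summable_of_bound (R : realType) (f : nat -> nat) (C : R) :
  (forall n, \sum_(0 <= m < n) 2 ^+ m * 2^-1 ^+ f m <= C) ->
  (\sum_(0 <= n <oo) ((2 : R) ^ (n%:Z - (f n)%:Z))%:E < +oo)%E.
Proof.
move=> h; apply: (@le_lt_trans _ _ C%:E); last by rewrite ltry.
apply: lime_le.
  apply: is_cvg_nneseries => n _ _.
  by rewrite lee_fin two_powB mulr_ge0 ?exprn_ge0 ?invr_ge0.
exists 0%N => // n _ /=; rewrite sumEFin lee_fin; apply: le_trans (h n).
by rewrite le_eqVlt; apply/orP; left; apply/eqP; apply: eq_bigr => m _; rewrite two_powB.
Qed.

Section KraftCount.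
Variables (R : realType) (s : seq str).

Let D l := count (fun p => size p <= l)%N s.
Let S l : R := \sum_(p <- s | (size p <= l)%N) 2^-1 ^+ size p.

Lemma short_weight_ge l : (D l)%:R * 2^-1 ^+ l <= S l.
Proof.
rewrite /D /S; elim: s => [|p r IH] /=; first by rewrite big_nil mul0r.
rewrite big_cons; case: ifP => h; last by rewrite add0n.
by rewrite natrD mulrDl mul1r lerD // half_pow_le.
Qed.

Lemma short_weight_step l l' : (l <= l')%N ->
  S l + ((D l')%:R - (D l)%:R) * 2^-1 ^+ l' <= S l'.
Proof.
move=> ll'; rewrite /D /S; elim: s => [|p r IH] /=.
  by rewrite !big_nil subrr mul0r addr0.
rewrite !big_cons; case: (leqP (size p) l) => h.
  rewrite (leq_trans h ll') !natrD; move: IH; lra.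
case: ifP => h'; last by rewrite !add0n.
rewrite add0n add1n -natr1.
have : 2^-1 ^+ l' <= 2^-1 ^+ size p :> R by rewrite half_pow_le.
by move: IH; lra.
Qed.

(** Strings as numerous as [2 ^ (n - k)] up to length [l n], for every [n],
    weigh at least a fixed fraction of the sum of the [2 ^ n / 2 ^ l n]:
    summation by parts, with each string charged to the first [n] for which
    [l n] reaches its length. *)
Lemma kraft_count (l : nat -> nat) N k : {homo l : m n / (m <= n)%N} ->
  wt R s <= 1 -> (forall n, (n <= N)%N -> (2 ^ n <= 2 ^ k * (D (l n)).+1)%N) ->
  \sum_(0 <= m < N.+1) 2 ^+ m * 2^-1 ^+ l m <= 2 ^+ k.+2 :> R.
Proof.
move=> l_mono w1 hD.
pose c n : R := (D (l n))%:R + 1.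
have hc n : (n <= N)%N -> 0 <= c n - 2 ^+ n * 2^-1 ^+ k.
  move=> /hD; rewrite -[(D _).+1]addn1 -(ler_nat R) natrM natrD !natrX => h.
  rewrite subr_ge0.
  by rewrite exprVn ler_pdivrMr ?exprn_gt0 // mulrC.
have claim n : (n <= N)%N ->
  2^-1 ^+ k.+1 * (\sum_(0 <= m < n.+1) 2 ^+ m * 2^-1 ^+ l m) +
  (c n - 2 ^+ n * 2^-1 ^+ k) * 2^-1 ^+ l n <= S (l n) + 2^-1 ^+ l 0%N.
  elim: n => [_|n IH nN].
    rewrite big_nat1 !expr0 !mul1r; have := short_weight_ge (l 0%N).
    have : 2^-1 ^+ k.+1 * 2^-1 ^+ l 0%N <= 2^-1 ^+ k * 2^-1 ^+ l 0%N :> R.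
      by rewrite ler_pM2r ?half_pow_gt0 // half_pow_le.
    rewrite /c; lra.
  have {}IH := IH (ltnW nN).
  have h1 := short_weight_step (l_mono _ _ (leqnSn n)).
  have h2 : 0 <= (c n - 2 ^+ n * 2^-1 ^+ k) * (2^-1 ^+ l n - 2^-1 ^+ l n.+1).
    by rewrite mulr_ge0 ?hc 1?ltnW // subr_ge0 half_pow_le l_mono.
  rewrite big_nat_recr //= [2 ^+ n.+1]exprS; move: IH h1 h2.
  rewrite /c (half_pow_double R k).
  set x := 2^-1 ^+ k.+1; set y := 2 ^+ n; set a := 2^-1 ^+ l n; set a' := 2^-1 ^+ l n.+1.
  set d := (D _)%:R; set d' := (D _)%:R; set z := \sum_(0 <= _ < _) _.
  by nra.
have S1 : S (l N) <= 1.
  apply: le_trans w1; rewrite /S /wt [leRHS](bigID (fun p => size p <= l N)%N) /=.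
  by rewrite lerDl sumr_ge0 // => p _; rewrite ltW // half_pow_gt0.
have a1 : 2^-1 ^+ l 0%N <= 1 :> R by rewrite exprn_ile1 ?invr_ge0 // invf_le1 // ler1n.
have h0 : 0 <= (c N - 2 ^+ N * 2^-1 ^+ k) * 2^-1 ^+ l N.
  by rewrite mulr_ge0 ?hc // ltW // half_pow_gt0.
have h : 2^-1 ^+ k.+1 * (\sum_(0 <= m < N.+1) 2 ^+ m * 2^-1 ^+ l m) <= 2 :> R.
  have := claim N (leqnn N); move: h0 S1 a1.
  by set u := (c N - _) * _; set z := _ * (\sum_(0 <= _ < _) _); lra.
rewrite exprS; set z := \sum_(0 <= _ < _) _ in h *.
have -> : z = 2 ^+ k.+1 * (2^-1 ^+ k.+1 * z) by rewrite mulrA half_powK mul1r.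
by rewrite [leRHS]mulrC ler_pM2l ?exprn_gt0.
Qed.

End KraftCount.

Section Necessity.
Variables (R : realType) (V W : str -> option str) (MV MW M : oracle_tm).
Hypotheses (optV : optimal V) (pfW : prefix_free (dom W)).
Hypothesis VM : forall x y, V x = Some y <-> exists t, out MV [::] x t = Some y.
Hypothesis WM : forall x y, W x = Some y <-> exists t, out MW [::] x t = Some y.
Variable l : nat -> nat.
Hypotheses (l_mono : {homo l : m n / (m <= n)%N}) (comp_l : comp l).
Hypothesis red : turing_reducible_via M (Pf (Omega R V)) (dom W).
Hypothesis redq : forall x q, queries M (dom W) x q -> (size q <= l (size x))%N.

Let pfV : prefix_free (dom V). Proof. by case: optV => -[]. Qed.

Lemma flo_lt n t : (flo MV n t < 2 ^ n)%N.
Proof. by apply: leq_ltn_trans (flo_le_tf R pfV VM _ _) (tf_lt R optV VM _). Qed.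

Lemma eventually_ol n : exists T, forall t, (T <= t)%N ->
  {in strsle (l n), forall q, (q \in dl MW t) = (q \in dom W)}.
Proof.
apply: (@eventually_all _ _ (fun q t => (q \in dl MW t) = (q \in dom W))) => q _.
case: (boolP (q \in dom W)) => [|qW].
  by rewrite inE => /(dom_dl WM)[T hT]; exists T => t /hT.
exists 0%N => t _; apply/negbTE; apply: contra qW => /(dl_dom WM).
by rewrite inE.
Qed.

(** In the long run the known part of the oracle is complete up to the length that
    the reduction asks for, and the digits are correct. *)
Lemma eventually_matched N : exists T, forall t, (T <= t)%N -> matched MV MW M l N t.
Proof.
have [|T hT] := @eventually_all _ (iota 0 N.+1) (fun n t => correct MV MW M l n t).
  move=> n _; have [T1 h1] := eventually_ol n; have [T2 h2] := flo_tf R optV VM n.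
  pose good x t := isSome (out M (ol MW l n t) x t) &&
    (odflt [::] (out M (ol MW l n t) x t) == [:: x == bits n (flo MV n t)]).
  have [|T hT] := @eventually_all _ (strs n) (fun x t => good x t).
    move=> x; rewrite mem_strs => /eqP sx; have [T3 [h3 e3]] := red x.
    exists (maxn T1 (maxn T2 T3)) => t; rewrite !geq_max => /and3P[le1 le2 le3].
    have agree q : queries M (dom W) x q -> (q \in dom W) = (q \in olist (ol MW l n t)).
      move=> /redq; rewrite sx => sq.
      by rewrite in_olist mem_filter sq (h1 _ le1) // mem_strsle.
    have e : out M (ol MW l n t) x T3 = Some [:: x \in Pf (Omega R V)].
      by rewrite /out -(run_agree _ agree) h3 e3.
    by rewrite /good (out_mono le3 e) /= (mem_Pf R optV VM) sx h2.
  by exists T => t /hT h; apply/allP => x /h.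
by exists T => t /hT h; apply/allP => n /h.
Qed.

Variable Nf : nat -> nat.
Hypotheses (comp_Nf : comp Nf) (Nf_ge : forall e, (e.*2.+1 <= Nf e)%N).

(** The machine for the [e]-th budget has all strings of one length at its
    disposal, each of which pushes [Omega] once.  The unary header makes the
    budgets jointly prefix-free.  When [e] is the constant of the optimal machine,
    header, payload and constant add up to [Nf e], so that each push carries
    [Omega] past a multiple of [2 ^- Nf e]; then the digits have changed, and the
    next match, which always comes, allows the next push. *)
Lemma all_kicks_happen : exists e t,
  (2 ^ (Nf e - e.*2.+1) <= size (kicks MV MW M l (Nf e) t))%N.
Proof.
pose hd (q : str) := index false q; pose rest (q : str) := drop (hd q).+1 q.
pose K e t := kicks MV MW M l (Nf e) t.
pose P (q : str) t := [&& false \in q, size (rest q) == (Nf (hd q) - (hd q).*2.+1)%N &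
  (binval (rest q) < size (K (hd q) t.+1))%N].
have hP : comp (fun v : str * nat => P v.1 v.2).
  have h1 : comp (fun v : str * nat => hd v.1) by rewrite /hd; comp_tac.
  have h2 : comp (fun v : str * nat => Nf (hd v.1)) by apply: (comp_comp comp_Nf h1).
  have h3 : comp (fun v : str * nat => rest v.1) by rewrite /rest; comp_tac.
  have h4 : comp (fun v : str * nat => K (hd v.1) v.2.+1).
    by apply: comp_kicks => //; comp_tac.
  by rewrite /P; comp_tac.
have [|d hd'] := kick R optV VM hP.
  move=> p q t t' /and3P[fp /eqP sp _] /and3P[fq /eqP sq _] pq.
  have [e _] := header_prefix pq fp; apply/eqP.
  have sizeq r : false \in r -> size r = ((hd r).+1 + size (rest r))%N.
    by move=> h; rewrite size_drop subnKC // index_mem.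
  have {}e : hd q = hd p by [].
  have e' : size p = size q by rewrite (sizeq p fp) (sizeq q fq) sp sq e.
  by have := pq; rewrite prefixE e' take_size eq_sym.
pose N := Nf d; pose lam := (N - d.*2.+1)%N.
exists d; suff reach i : (i <= 2 ^ lam)%N -> exists t, (i <= size (K d t))%N.
  exact: reach (leqnn _).
elim: i => [_|i IH ilam]; first by exists 0%N.
have {IH} ex := IH (ltnW ilam); have [t1 ht1 t1min] := ex_minnP ex.
have [T hT] := eventually_matched N.
have [T' hT'] := flo_tf R optV VM N.
have [t [le1 le2 le3]] : exists t, [/\ t1 <= t, T <= t & T' <= t]%N.
  by exists (maxn t1 (maxn T T')); rewrite !leq_max !leqnn !orbT.
have [s es] := kicks_mono MV MW M l N le1.
(* At [t] there is a match; [t] is a push, unless one has occurred since [t1], if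
   the digits have changed since the last push. *)
suff hall : all (fun r => flo MV N r < flo MV N t)%N (K d t1).
  case: s es => [es|r s es]; last first.
    by exists t; rewrite /K es /= size_cat ltnS (leq_trans ht1) // leq_addl.
  by exists t.+1; rewrite /K kicksS hT //= -/N es /= hall /= ltnS.
case: i ilam ex t1min ht1 => [|i] ilam ex t1min ht1.
  have := t1min 0%N isT; rewrite leqn0 => /eqP t10.
  by rewrite t10.
case: t1 ht1 t1min le1 es => [|r] // hr rmin le1 es.
have nr : ~~ (i.+1 <= size (K d r))%N by apply/negP => /rmin; rewrite ltnn.
have er : K d r.+1 = r :: K d r /\ all (fun r' => flo MV N r' < flo MV N r)%N (K d r).
  have := kicksS MV MW M l N r; rewrite -/(K d r) -/(K d r.+1).
  by case: ifP => [/andP[_ h] //|_ e]; rewrite e (negPf nr) in hr.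
have [eK hall] := er.
pose q := nseq d true ++ false :: bits lam i.
have fq : false \in q by rewrite mem_cat inE eqxx orbT.
have hq : hd q = d by rewrite /hd /q index_cat mem_nseq andbF size_nseq /= addn0.
have rq : rest q = bits lam i.
  by rewrite /rest hq /q drop_cat size_nseq ltnNge leqnSn /= subSn // subnn /= drop0.
have bq : binval (rest q) = i by rewrite rq bitsK // ltnW.
have sq : (size q + d = N)%N.
  rewrite /q size_cat size_nseq /= size_bits /lam.
  by have := Nf_ge d; rewrite -/N -addnn; lia.
have Pr : P q r.
  by rewrite /P fq hq {1}rq size_bits eqxx bq.
have nP k : (k < r)%N -> ~~ P q k.
  move=> kr; rewrite /P fq hq bq /= negb_and; apply/orP; right.
  by apply/negP => /rmin; rewrite ltnS leqNgt kr.
have := hd' q r Pr nP; rewrite sq => hO.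
have lt : (flo MV N r < flo MV N t)%N.
  rewrite (hT' _ le3) -ltnS -(ltr_nat R).
  have /andP[_ h1] := tfP R pfV N; have /andP[h2 _] := floP R MV N r.
  apply: le_lt_trans h1; apply: le_trans (_ : 2 ^+ N * om R MV r + 1 <= _).
    by rewrite -natr1 lerD2r.
  have : 2 ^+ N * (om R MV r + 2^-1 ^+ N) <= 2 ^+ N * Omega R V.
    by rewrite ler_pM2l ?exprn_gt0.
  by rewrite mulrDr half_powK.
rewrite eK /= lt /=; apply: sub_all hall => r' h; exact: ltn_trans h lt.
Qed.

End Necessity.

Section Summability.
Variables (R : realType) (V W : str -> option str).
Hypotheses (optV : optimal V) (optW : optimal W).

Lemma summable_of_reducible (f : nat -> nat) c : order_function f ->
  reducible_in_query_size (fun n => (f n + c)%N) (Pf (Omega R V)) (dom W) ->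
  (\sum_(0 <= n <oo) ((2 : R) ^ (n%:Z - (f n)%:Z))%:E < +oo)%E.
Proof.
move=> [f_mono /total_recursive_comp hf _] [M hM hq].
have [[[prV pfV] _] [[prW pfW] _]] := (optV, optW).
have [MV VM] := partial_recursive_out prV.
have [MW WM] := partial_recursive_out prW.
pose l n := (f n + c)%N.
have l_mono : {homo l : m n / (m <= n)%N} by move=> m n mn; rewrite leq_add2r f_mono.
have comp_l : comp l by rewrite /l; comp_tac.
apply: contrapT => nS.
pose T N := \sum_(0 <= m < N) 2 ^+ m * 2^-1 ^+ l m : R.
have unbounded (C : R) : exists N, C < T N.
  apply: contrapT => no; apply: nS; apply: (@summable_of_bound R f (C * 2 ^+ c)) => n.
  have -> : \sum_(0 <= m < n) 2 ^+ m * 2^-1 ^+ f m = T n * 2 ^+ c :> R.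
    rewrite /T mulr_suml; apply: eq_bigr => m _; rewrite exprD -!mulrA.
    by rewrite [2^-1 ^+ c * _]mulrC half_powK mulr1.
  rewrite ler_pM2r ?exprn_gt0 // leNgt; apply/negP => lt; apply: no.
  by exists n.
pose big e N := (e.*2.+1 <= N)%N && (2 ^ (e.*2.+3 + l N) < pos l N + 2 ^ N)%N.
have bigE e N : (2 ^ (e.*2.+3 + l N) < pos l N + 2 ^ N)%N = (2 ^+ e.*2.+3 < T N.+1).
  rewrite -(ltr_nat R) (pos_sum l_mono) natrX exprD mulrC.
  by rewrite ltr_pM2l ?exprn_gt0.
have T_mono m n : (m <= n)%N -> T m <= T n.
  move=> /subnKC <-; elim: (n - m)%N => [|k IH]; first by rewrite addn0.
  rewrite addnS; apply: le_trans IH _; rewrite /T big_nat_recr //= lerDl.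
  by rewrite mulr_ge0 ?exprn_ge0 ?invr_ge0.
have ex e : exists N, big e N.
  have [N hN] := unbounded (2 ^+ e.*2.+3); exists (maxn N e.*2.+1).
  rewrite /big bigE leq_maxr /=; apply: lt_le_trans hN _; apply: T_mono.
  by rewrite leqW // leq_maxl.
have comp_Nf : comp (fun e => ex_minn (ex e)).
  apply: (comp_search (P := big)).
  - have h1 : comp (fun u : nat * nat => pos l u.2) by apply: comp_pos; comp_tac.
    have h2 : comp (fun u : nat * nat => l u.2) by apply: (comp_comp comp_l); comp_tac.
    by rewrite /big; comp_tac.
  - by move=> e; case: ex_minnP.
  - by move=> e k; case: ex_minnP => m _ mmin; rewrite ltnNge; apply: contra => /mmin.
have Nf_ge e : (e.*2.+1 <= ex_minn (ex e))%N by case: ex_minnP => m /andP[].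
have [e [t]] := all_kicks_happen optV VM WM comp_l hM hq comp_Nf Nf_ge.
case: ex_minnP => N /andP[Ne bigN] _ hk; move: bigN; rewrite bigE; apply/negP; rewrite -leNgt.
case eK : (kicks MV MW M l N t) hk => [|r K]; first by rewrite leqn0 expn_eq0.
move=> hk.
apply: (@kraft_count R (dl MW r) l N e.*2.+1 l_mono).
  by apply: (wt_le1 R pfW); [exact: uniq_dl | exact: (dl_dom WM)].
move=> n nN; have [_ _ hc] := kicks_count (flo_lt R optV VM) nN eK.
have h1 : (2 ^ (N - e.*2.+1) <= 2 ^ (N - n) * (size (ol MW l n r)).+1)%N.
  apply: leq_trans hk (leq_trans hc _).
  by rewrite mulnSr -addnA leq_add2l addn1 ltn_mod expn_gt0.
have : (2 ^ e.*2.+1 * 2 ^ (N - e.*2.+1) <=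
        2 ^ e.*2.+1 * (2 ^ (N - n) * (size (ol MW l n r)).+1))%N.
  by rewrite leq_pmul2l ?expn_gt0.
rewrite -expnD subnKC // mulnCA -{1}(subnK nN) expnD leq_pmul2l ?expn_gt0 //.
by rewrite size_filter.
Qed.

End Summability.

(** * The equivalence *)

Theorem theorem4p1 (R : realType) (V W : str -> option str)
    (hV : optimal V) (hW : optimal W) (f : nat -> nat)
    (hf : order_function f) :
  (exists c : nat,
     reducible_in_query_size (fun n => (f n + c)%N) (Pf (Omega R V)) (dom W))
  <->
  (\sum_(0 <= n <oo) ((2 : R) ^ (n%:Z - (f n)%:Z))%:E < +oo)%E.
Proof.
split=> [[c h]|h]; first exact: summable_of_reducible hf h.
exact: reducible_of_summable.
Qed.
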